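(* Suppose $w\in F$ is positive. Then $R$ is locally constant from the right at rational points; i.e. for every pair of rational numbers $r$ and $s$, there is an $\epsilon(r,s)>0$ so that $R(w,\cdot,\cdot)$ is constant on $[r,r+\epsilon)\times[s,s+\epsilon)$. Conversely, if $R(w,r,s)=p/q$ (where $p/q$ is reduced) and the biggest power of consecutive $a$'s in $w$ (resp. $b$'s) is $a^m$ (resp. $b^n$), then $R(w,r+\frac{1}{mq},s)\ge \frac pq+\frac1{q^2}$ (resp. $R(w,r,s+\frac{1}{nq})\ge \frac pq+\frac1{q^2}$).
   Context: $F$ is the free group on two generators $a,b$. A word in $F$ is positive if it contains only the letters $a$ and $b$, and no $a^{-1}$ or $b^{-1}$. $\mathrm{Homeo}^+(S^1)^\sim$ denotes the group of increasing homeomorphisms of $\mathbb{R}$ commuting with $x\mapsto x+1$ (lifts of orientation-preserving homeomorphisms of $S^1=\mathbb{R}/\mathbb{Z}$), and $\mathrm{rot}^\sim(\varphi)=\lim_{n\to\infty}(\varphi^n(x)-x)/n\in\mathbb{R}$ is the real-valued Poincaré rotation number. For $w\in F$ and $r,s\in\mathbb{R}$, $R(w,r,s)$ denotes the supremum of $\mathrm{rot}^\sim(\rho(w))$ over all homomorphisms $\rho:F\to \mathrm{Homeo}^+(S^1)^\sim$ with $\mathrm{rot}^\sim(\rho(a))=r$ and $\mathrm{rot}^\sim(\rho(b))=s$.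
   Formalization: In the first part, w is assumed not to be a power a^k or b^k with k≥1, because there R(w,r,s)=kr (resp. ks) is strictly increasing and local constancy fails; the second part keeps all positive words, each bound being stated when its letter occurs in w. *)

(* Defs.v *)
From HB Require Import structures.
From mathcomp Require Import all_boot all_order all_algebra.
From mathcomp Require Import all_classical all_reals all_analysis.
Set Implicit Arguments.
Unset Strict Implicit.
Unset Printing Implicit Defensive.
Import Order.TTheory GRing.Theory Num.Theory.
Import numFieldNormedType.Exports.
Local Open Scope classical_set_scope.
Local Open Scope ring_scope.

(* The free group on X as the group of reduced words. The letter (x, false)
   stands for x and the letter (x, true) for its inverse. *)

Section FreeGroup.
Variable X : choiceType.
Implicit Types (l : X * bool) (s t u : seq (X * bool)).

Definition linv l : X * bool := (l.1, ~~ l.2).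

Definition reduced s := sorted (fun l l' => l' != linv l) s.

Record free_group := FreeWord {
  word :> seq (X * bool);
  word_reduced : reduced word }.

HB.instance Definition _ := [isSub for word].
HB.instance Definition _ := [Choice of free_group by <:].

(* Left multiplication of a reduced word by one letter. *)
Definition push l s : seq (X * bool) :=
  if s is l' :: s' then if l' == linv l then s' else l :: s else [:: l].

Definition word_mul s t := foldr push t s.

Definition word_inv s := rev (map linv s).

Lemma linvK : involutive linv.
Proof. by case=> x b; rewrite /linv /= negbK. Qed.

Lemma reduced_push l s : reduced s -> reduced (push l s).
Proof.
case: s => [|l' s] //= rs; case: ifPn => [_|ne]; first exact: path_sorted rs.
by rewrite /= ne.
Qed.

Lemma push_linv l s : reduced s -> push l (push (linv l) s) = s.
Proof.
case: s => [|l' s] /=; first by rewrite eqxx.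
rewrite linvK; case: eqP => [-> | _ _]; last by rewrite /= eqxx.
by case: s => [|l'' s] //= /andP[/negbTE->].
Qed.

Lemma linv_push l s : reduced s -> push (linv l) (push l s) = s.
Proof. by move=> rs; rewrite -{2}[l]linvK push_linv. Qed.

Lemma reduced_mul s t : reduced t -> reduced (word_mul s t).
Proof. by move=> rt; elim: s => //= l s; apply: reduced_push. Qed.

Lemma word_mul_push l s t :
  reduced t -> word_mul (push l s) t = push l (word_mul s t).
Proof.
move=> rt; case: s => [|l' s] //=; case: eqP => [-> | _] //=.
by rewrite push_linv //; exact: reduced_mul.
Qed.

Lemma word_mulA s t u :
  reduced u -> word_mul s (word_mul t u) = word_mul (word_mul s t) u.
Proof. by move=> ru; elim: s => //= l s ->; rewrite word_mul_push. Qed.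

Lemma word_mulw1 s : reduced s -> word_mul s [::] = s.
Proof.
elim: s => //= l s IHs rs; rewrite IHs; last exact: path_sorted rs.
by case: s rs {IHs} => //= l' s /andP[/negbTE->].
Qed.

Lemma word_invK : involutive word_inv.
Proof. by move=> s; rewrite /word_inv map_rev revK mapK //; exact: linvK. Qed.

Lemma reduced_inv s : reduced s -> reduced (word_inv s).
Proof.
rewrite /reduced /word_inv rev_sorted sorted_map; apply: sub_sorted => l l' /=.
by case: l l' => x c [y d]; rewrite /linv !xpair_eqE /= negbK eq_sym; case: c d => [] [].
Qed.

Lemma word_mulVw s : word_mul (word_inv s) s = [::].
Proof.
elim: s => //= l s IHs.
by rewrite /word_inv /= rev_cons /word_mul foldr_rcons /= linvK eqxx.
Qed.

Definition fg_one : free_group := FreeWord (isT : reduced [::]).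
Definition fg_mul (v w : free_group) : free_group :=
  FreeWord (reduced_mul v (word_reduced w)).
Definition fg_inv (w : free_group) : free_group :=
  FreeWord (reduced_inv (word_reduced w)).

Lemma fg_mulA : associative fg_mul.
Proof.
by move=> u v w; apply: val_inj => /=; apply: word_mulA; exact: word_reduced.
Qed.

Lemma fg_mul1g : left_id fg_one fg_mul.
Proof. by move=> w; apply: val_inj. Qed.

Lemma fg_mulg1 : right_id fg_one fg_mul.
Proof. by move=> w; apply: val_inj; apply: word_mulw1; exact: word_reduced. Qed.

Lemma fg_mulVg : left_inverse fg_one fg_inv fg_mul.
Proof. by move=> w; apply: val_inj; exact: word_mulVw. Qed.

Lemma fg_mulgV : right_inverse fg_one fg_inv fg_mul.
Proof.
move=> w; apply: val_inj => /=; rewrite -{1}[word w]word_invK.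
exact: word_mulVw.
Qed.

HB.instance Definition _ :=
  isGroup.Build free_group fg_mulA fg_mul1g fg_mulg1 fg_mulVg fg_mulgV.

Definition fg_gen (x : X) : free_group :=
  FreeWord (isT : reduced [:: (x, false)]).

Definition positive_word (w : free_group) : bool := all (fun l => ~~ l.2) w.

(* The largest k such that x^k occurs as a block of consecutive letters of w;
   it is 0 when the letter x does not occur in w. *)
Definition max_power (x : X) (w : free_group) : nat :=
  (\max_(k < (size w).+1 | infix (nseq k (x, false)) w) k)%N.

End FreeGroup.

Definition F2 := free_group bool.
HB.instance Definition _ := Group.on F2.
Definition letter_a := true.
Definition letter_b := false.
Definition gen_a : F2 := fg_gen letter_a.
Definition gen_b : F2 := fg_gen letter_b.

(* The inverse is a field of the record; it is determined by the underlying
   function, so that two elements with the same function are equal. *)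

Section LiftedHomeo.
Variable R : realType.

Record lifted_homeo := LiftedHomeo {
  lh_fun :> R -> R;
  lh_inv : R -> R;
  lh_funK : cancel lh_fun lh_inv;
  lh_invK : cancel lh_inv lh_fun;
  lh_cont : continuous lh_fun;
  lh_inv_cont : continuous lh_inv;
  lh_incr : {homo lh_fun : x y / x < y};
  lh_comm : forall x, lh_fun (x + 1) = lh_fun x + 1 }.

HB.instance Definition _ := gen_eqMixin lifted_homeo.
HB.instance Definition _ := gen_choiceMixin lifted_homeo.

Lemma lifted_homeoP (f g : lifted_homeo) : lh_fun f =1 lh_fun g -> f = g.
Proof.
case: f g => [f f' fK f'K cf cf' fi fc] [g g' gK g'K cg cg' gi gc] /= /funext fg.
subst g; have f'g' : f' = g'.
  by apply/funext => x; rewrite -{1}[x]g'K fK.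
subst g'; congr LiftedHomeo; exact: Prop_irrelevance.
Qed.

Definition lh_one : lifted_homeo.
Proof.
by apply: (@LiftedHomeo idfun idfun) => // x; exact: cvg_id.
Defined.

Definition lh_mul (f g : lifted_homeo) : lifted_homeo.
Proof.
apply: (@LiftedHomeo (f \o g) (lh_inv g \o lh_inv f)).
- exact: can_comp (@lh_funK f) (@lh_funK g).
- exact: can_comp (@lh_invK g) (@lh_invK f).
- by move=> x; apply: continuous_comp; exact: lh_cont.
- by move=> x; apply: continuous_comp; exact: lh_inv_cont.
- by move=> x y xy /=; do 2 apply: lh_incr.
- by move=> x /=; rewrite !lh_comm.
Defined.

Definition lh_opp (f : lifted_homeo) : lifted_homeo.
Proof.
apply: (@LiftedHomeo (lh_inv f) f).
- exact: lh_invK.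
- exact: lh_funK.
- exact: lh_inv_cont.
- exact: lh_cont.
- move=> x y; apply: contraTT; rewrite -!leNgt le_eqVlt => /predU1P[e|].
    by rewrite -[y](@lh_invK f) e lh_invK.
  by move=> /(@lh_incr f); rewrite !lh_invK => /ltW.
- by move=> x; rewrite -{1}[x](@lh_invK f) -lh_comm lh_funK.
Defined.

Lemma lh_mulA : associative lh_mul.
Proof. by move=> f g h; apply: lifted_homeoP. Qed.

Lemma lh_mul1g : left_id lh_one lh_mul.
Proof. by move=> f; apply: lifted_homeoP. Qed.

Lemma lh_mulg1 : right_id lh_one lh_mul.
Proof. by move=> f; apply: lifted_homeoP. Qed.

Lemma lh_mulVg : left_inverse lh_one lh_opp lh_mul.
Proof. by move=> f; apply: lifted_homeoP => x; exact: lh_funK. Qed.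

Lemma lh_mulgV : right_inverse lh_one lh_opp lh_mul.
Proof. by move=> f; apply: lifted_homeoP => x; exact: lh_invK. Qed.

HB.instance Definition _ :=
  isGroup.Build lifted_homeo lh_mulA lh_mul1g lh_mulg1 lh_mulVg lh_mulgV.

(* The limit of (phi^n(x) - x) / n does not depend on x; x = 0 is used. *)
Definition rot_num (phi : lifted_homeo) : R :=
  lim ((fun n : nat => (iter n phi 0 - 0) / n%:R) @ \oo).

(* Taken in the extended reals, where every set has a supremum. A multiplicative
   map between groups is a group homomorphism. *)
Definition maxrot (w : F2) (r s : R) : \bar R :=
  ereal_sup [set (rot_num (rho w))%:E | rho in
    [set rho : {multiplicative F2 -> lifted_homeo} |
      rot_num (rho gen_a) = r /\ rot_num (rho gen_b) = s]].

End LiftedHomeo.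

(* Main.v *)
Require Import Defs.
From HB Require Import structures.
From mathcomp Require Import all_boot all_order all_algebra.
From mathcomp Require Import all_classical all_reals all_analysis.
From mathcomp Require Import ring lra zify.
Set Implicit Arguments.
Unset Strict Implicit.
Unset Printing Implicit Defensive.
Import Order.TTheory GRing.Theory Num.Theory.
Import numFieldNormedType.Exports.
Local Open Scope classical_set_scope.
Local Open Scope ring_scope.

(** Positive words are monotone in their letters, so maps are only ever compared.

    Local constancy: let k/n be slightly above p/q, with k q = p n + 1 and n large.
    A map of rotation number k/n permutes an orbit of n points per turn, which splits
    into many clusters, each following a q-periodic pattern up to one step. Breaking
    the orbit inside a single cluster yields a map of rotation number p/q that nearly
    jumps from each of its q points to the next one. A pigeonhole argument selects
    clusters for a and b that are disjoint; then whatever is lost inside a cluster of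
    one letter is regained as soon as the other letter is applied, so the rotation
    number of the word does not drop.

    Lower bound: in a suitable averaged coordinate all maps are 8-Lipschitz, so the
    maximum is attained and upper semicontinuous. Take an orbit y_j of rotation number
    p/q of the word read from the end of a block a^m. Replacing a by a map with a
    finite orbit of n points per turn, some gap [y_j, y_(j+1)) contains at most n/q of
    these points, and shifting them by about n/(mq) carries a^m y_j past the old
    a^m y_(j+1). This gains one point of the orbit in every q steps. *)

(** * Rotation numbers *)

Section RotationNumber.
Variable R : realType.
Implicit Types (f g : lifted_homeo R) (x y : R) (k n : nat) (i j z : int).

Lemma lh_lt f x y : (f x < f y) = (x < y).
Proof.
apply/idP/idP; last exact: lh_incr.
by apply: contraTT; rewrite -!leNgt le_eqVlt => /predU1P[->//|/(@lh_incr _ f)/ltW].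
Qed.

Lemma lh_le f x y : (f x <= f y) = (x <= y).
Proof. by rewrite !leNgt lh_lt. Qed.

Lemma lh_inj f : injective f.
Proof. exact: can_inj (@lh_funK _ f). Qed.

Lemma lh_addn f x n : f (x + n%:R) = f x + n%:R.
Proof.
elim: n => [|n IH]; first by rewrite !addr0.
by rewrite -natr1 !addrA lh_comm IH.
Qed.

Lemma lh_addz f x z : f (x + z%:~R) = f x + z%:~R.
Proof.
case: z => n; first exact: lh_addn.
by rewrite NegzE mulrNz -[in RHS](subrK n.+1%:R x) lh_addn addrK.
Qed.

Lemma iter_le f n x y : (iter n f x <= iter n f y) = (x <= y).
Proof. by elim: n => //= n <-; rewrite lh_le. Qed.

Lemma iter_lt f n x y : (iter n f x < iter n f y) = (x < y).
Proof. by rewrite !ltNge iter_le. Qed.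

Lemma iter_addz f n x z : iter n f (x + z%:~R) = iter n f x + z%:~R.
Proof. by elim: n => //= n ->; rewrite lh_addz. Qed.

Lemma iter_mono f g n x y :
  (forall t, f t <= g t) -> x <= y -> iter n f x <= iter n g y.
Proof. by move=> fg xy; elim: n => //= n IH; rewrite (le_trans _ (fg _)) ?lh_le. Qed.

Lemma floor_approx x : exists z : int, z%:~R <= x < z%:~R + 1.
Proof.
by exists (Num.floor x); rewrite -[1]/(1%:~R) -intrD floor_itv.
Qed.

(** If f^n(0) lies in [z, z + 1) with z an integer, then f^(m+n)(0) lies between f^m(0) + z and
    f^m(0) + z + 1. *)
Lemma iter_quasi f m n :
  `|iter (m + n) f 0 - iter m f 0 - iter n f 0| <= 1.
Proof.
rewrite iterD; have [z /andP[z1 z2]] := floor_approx (iter n f 0).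
have h1 : iter m f 0 + z%:~R <= iter m f (iter n f 0).
  by rewrite -iter_addz iter_le add0r.
have h2 : iter m f (iter n f 0) <= iter m f 0 + (z + 1)%:~R.
  by rewrite -iter_addz iter_le add0r intrD ltW.
rewrite intrD in h2; rewrite ler_norml; apply/andP; split; lra.
Qed.

Lemma iter_quasiM f m n :
  `|iter (n.+1 * m) f 0 - n.+1%:R * iter m f 0| <= n%:R.
Proof.
elim: n => [|n IH]; first by rewrite mul1n mul1r subrr normr0.
have := iter_quasi f m (n.+1 * m); rewrite -mulSn => H.
move: IH H; rewrite !ler_norml => /andP[a b] /andP[c d].
by rewrite -[n.+2%:R]natr1 -[in X in _ <= X]natr1 -[in X in X <= _]natr1; apply/andP; split; lra.
Qed.

(** Each (f^m(0) - 1)/m is at most each (f^n(0) + 1)/n, by comparing both with f^(mn)(0). The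
    supremum of the former then has an error of at most 1, uniform in n and in f. *)
Lemma rot_ex f :
  exists r : R, forall n, `|iter n f 0 - n%:R * r| <= 1.
Proof.
pose A := [set a : R | exists n, a = (iter n.+1 f 0 - 1) / n.+1%:R]%classic.
have ub m n : (iter m.+1 f 0 - 1) / m.+1%:R <= (iter n.+1 f 0 + 1) / n.+1%:R.
  rewrite ler_pdivrMr ?ltr0Sn // mulrAC ler_pdivlMr ?ltr0Sn //.
  have := iter_quasiM f m.+1 n; have := iter_quasiM f n.+1 m.
  rewrite mulnC !ler_norml => /andP[a b] /andP[c d].
  rewrite -[m.+1%:R]natr1 -[n.+1%:R]natr1 in a b c d *; lra.
have hA : has_sup A.
  split; first by exists ((iter 1 f 0 - 1) / 1), 0%N.
  by exists ((iter 1 f 0 + 1)/ 1) => _ [n ->]; exact: (ub n 0%N).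
exists (sup A) => -[|n]; first by rewrite /= mul0r subrr normr0.
have h1 : (iter n.+1 f 0 - 1) / n.+1%:R <= sup A.
  by apply: ub_le_sup; [case: hA | exists n].
have h2 : sup A <= (iter n.+1 f 0 + 1) / n.+1%:R.
  by apply: ge_sup; [case: hA | move=> _ [m ->]; exact: ub].
rewrite ler_pdivrMr ?ltr0Sn // in h1; rewrite ler_pdivlMr ?ltr0Sn // in h2.
rewrite ler_norml; apply/andP; split; lra.
Qed.

Lemma rot_num_unique f (r C : R) :
  (forall n, `|iter n f 0 - n%:R * r| <= C) -> rot_num f = r.
Proof.
move=> H; rewrite /rot_num; apply: cvg_lim => //.
have C0 : 0 <= C by have := H 0%N; rewrite /= mul0r subrr normr0.
apply/cvgrPdist_lt => e e0; near=> n.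
have n0 : (0 < n)%N by near: n; exists 1%N.
rewrite subr0 distrC -(mulfK (_ : n%:R != 0) r) ?pnatr_eq0 -?lt0n // -mulrBl normrM.
rewrite [X in _ * X]ger0_norm ?invr_ge0 // ltr_pdivrMr ?ltr0n //.
rewrite [r * _]mulrC (le_lt_trans (H n)) //.
have : C / e < n%:R by near: n; exact: nbhs_infty_gtr.
by rewrite ltr_pdivrMr // mulrC.
Unshelve. all: by end_near. Qed.

Lemma rot_bound f n : `|iter n f 0 - n%:R * rot_num f| <= 1.
Proof. by have [r hr] := rot_ex f; rewrite (rot_num_unique hr). Qed.

Lemma iter_near0 f x : exists C, forall n, `|iter n f x - iter n f 0| <= C.
Proof.
have [z /andP[z1 z2]] := floor_approx x.
exists (`|z%:~R| + 1) => n.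
have h1 : iter n f 0 + z%:~R <= iter n f x by rewrite -iter_addz iter_le add0r.
have h2 : iter n f x <= iter n f 0 + (z + 1)%:~R.
  by rewrite -iter_addz iter_le add0r intrD ltW.
rewrite intrD in h2; have := ler_norm (z%:~R : R); have := ler_norm (- z%:~R : R).
rewrite normrN ler_norml => *; apply/andP; split; lra.
Qed.

Lemma le_of_mul_bounded (a b C : R) :
  (forall n, n%:R * a <= n%:R * b + C) -> a <= b.
Proof.
move=> H; rewrite leNgt; apply/negP => ba.
have [n hn] : exists n : nat, C / (a - b) < n%:R.
  exists (Num.truncn (`|C / (a - b)|)).+1.
  by rewrite (le_lt_trans (ler_norm _)) // truncnS_gt.
move: hn; rewrite ltr_pdivrMr ?subr_gt0 // => hn; have := H n; lra.
Qed.

Lemma rot_le_iter f g x y C :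
  (forall k, iter k f x <= iter k g y + C) -> rot_num f <= rot_num g.
Proof.
move=> H; have [Cf hf] := iter_near0 f x; have [Cg hg] := iter_near0 g y.
apply: (@le_of_mul_bounded _ _ (Cf + Cg + C + 2)) => k.
have := H k; have := hf k; have := hg k.
have := rot_bound f k; have := rot_bound g k.
rewrite !ler_norml => /andP[? ?] /andP[? ?] /andP[? ?] /andP[? ?] ?; lra.
Qed.

Lemma rot_mono f g : (forall x, f x <= g x) -> rot_num f <= rot_num g.
Proof.
by move=> fg; apply: (@rot_le_iter f g 0 0 0) => k; rewrite addr0 iter_mono.
Qed.

Lemma rot_ge_period f n z x : (0 < n)%N ->
  (forall k, x + k%:R * z%:~R <= iter (k * n) f x) -> z%:~R / n%:R <= rot_num f.
Proof.
move=> n0 H; have [Cf hf] := iter_near0 f x.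
have n0' : 0 < n%:R :> R by rewrite ltr0n.
rewrite ler_pdivrMr //.
apply: (@le_of_mul_bounded _ _ (Cf + 1 - x)) => k.
have := H k; have := hf (k * n)%N; have := rot_bound f (k * n).
rewrite !ler_norml natrM => /andP[? ?] /andP[? ?] ?; lra.
Qed.

Lemma iter_period f n z x k :
  iter n f x = x + z%:~R -> iter (k * n) f x = x + k%:R * z%:~R.
Proof.
move=> H; elim: k => [|k IH]; first by rewrite mul0r addr0.
rewrite mulSn iterD IH -[k%:R]/(k%:~R) -intrM iter_addz H intrM -natr1; ring.
Qed.

Lemma rot_period f n z x : (0 < n)%N ->
  iter n f x = x + z%:~R -> rot_num f = z%:~R / n%:R.
Proof.
move=> n0 H; apply/eqP; rewrite eq_le; apply/andP; split; last first.
  by apply: (@rot_ge_period f n z x n0) => k; rewrite (iter_period _ H).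
have [Cf hf] := iter_near0 f x.
have n0' : 0 < n%:R :> R by rewrite ltr0n.
rewrite ler_pdivlMr //; apply: (@le_of_mul_bounded _ _ (Cf + 1 + x)) => k.
have := hf (k * n)%N; have := rot_bound f (k * n).
rewrite (iter_period _ H) !ler_norml natrM => /andP[? ?] /andP[? ?]; lra.
Qed.

Lemma lh_transl_subproof (t : R) : exists f, forall x, f x = x + t.
Proof.
unshelve eexists (@LiftedHomeo R (fun x => x + t) (fun x => x - t) _ _ _ _ _ _) => //.
- by move=> x; rewrite addrK.
- by move=> x; rewrite subrK.
- by move=> x; apply: cvgD; [exact: cvg_id|exact: cvg_cst].
- by move=> x; apply: cvgB; [exact: cvg_id|exact: cvg_cst].
- by move=> x y xy; rewrite ltrD2r.
- by move=> x; rewrite addrAC.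
Qed.

Definition lh_transl t : lifted_homeo R := projT1 (cid (lh_transl_subproof t)).

Lemma lh_translE t x : lh_transl t x = x + t.
Proof. exact: (projT2 (cid (lh_transl_subproof t))). Qed.

Lemma rot_transl t : rot_num (lh_transl t) = t.
Proof.
apply: (@rot_num_unique _ _ 0) => n.
suff -> : iter n (lh_transl t) 0 = n%:R * t by rewrite subrr normr0.
by elim: n => [|n IH]; rewrite ?mul0r //= lh_translE IH -natr1 mulrDl mul1r.
Qed.

Lemma transl_mulE t f x : (lh_transl t * f)%g x = f x + t.
Proof. exact: lh_translE. Qed.

Lemma iter_transl_cont f n :
  continuous (fun t : R => iter n (lh_transl t * f)%g 0).
Proof.
elim: n => [|n IH] t; first exact: cvg_cst.
have -> : (fun t : R => iter n.+1 (lh_transl t * f)%g 0) =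
    (fun t => f (iter n (lh_transl t * f)%g 0) + t).
  by apply/funext => u; rewrite iterS transl_mulE.
apply: cvgD; last exact: cvg_id.
by apply: (continuous_comp (IH t)); exact: lh_cont.
Qed.

(** A fixed iterate is continuous in t and determines the rotation number up to 1/n. Two errors of 1
    and a variation below 1 stay under the 4 used to choose n. *)
Lemma rot_transl_cont f : continuous (fun t : R => rot_num (lh_transl t * f)%g).
Proof.
move=> t; apply/cvgrPdist_lt => e e0.
have [n hn] : exists n : nat, 4 / e < n.+1%:R.
  exists (Num.truncn (4 / e)); exact: truncnS_gt.
have n0 : 0 < n.+1%:R :> R by [].
have := @iter_transl_cont f n.+1 t.
move=> /cvgrPdist_lt/(_ 1 ltr01); apply: filterS => u /= h.
rewrite -(ltr_pM2l n0) -[X in X * `|_|]ger0_norm ?ltW // -normrM.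
have := rot_bound (lh_transl t * f)%g n.+1.
have := rot_bound (lh_transl u * f)%g n.+1; rewrite /=.
rewrite ltr_pdivrMr // in hn; move: h; rewrite ltr_norml.
rewrite !ler_norml ltr_norml => /andP[? ?] /andP[? ?] /andP[? ?].
apply/andP; split; lra.
Qed.

Lemma iter_transl_n f n k x :
  iter k (lh_transl n%:R * f)%g x = iter k f x + (k * n)%:R.
Proof.
elim: k => [|k IH]; first by rewrite addr0.
by rewrite iterS transl_mulE IH lh_addn -addrA -natrD mulSn addnC.
Qed.

Lemma rot_transl_n f n : rot_num (lh_transl n%:R * f)%g = rot_num f + n%:R.
Proof.
apply: (@rot_num_unique _ _ 1) => k; have := rot_bound f k.
by rewrite iter_transl_n natrM mulrDr opprD addrACA subrr addr0.
Qed.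

(** Composing with translations by t in [0, b], b an integer, moves the rotation number continuously
    up by b; the intermediate value theorem finds r. *)
Lemma rot_raise f r : rot_num f <= r ->
  exists g, rot_num g = r /\ forall x, f x <= g x.
Proof.
move=> fr; pose b := (Num.truncn (r - rot_num f)).+1.
have hb : r - rot_num f < b%:R by apply: truncnS_gt.
have e0 : (lh_transl 0 * f)%g = f.
  by apply: lifted_homeoP => x; rewrite transl_mulE addr0.
have [|||t] := @IVT R (fun t => rot_num (lh_transl t * f)%g) 0 b%:R r => //.
- apply: continuous_subspaceT => t; exact: rot_transl_cont.
- rewrite e0 rot_transl_n min_l ?lerDl ?max_r ?lerDl //; lra.
rewrite in_itv => /andP[t0 _] <-; exists (lh_transl t * f)%g; split=> // x.
by rewrite transl_mulE lerDl.
Qed.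

(** A monotone H commuting with the unit translation stays at bounded distance from the identity, so
    it maps an orbit of f to an orbit of g at bounded distance. *)
Lemma rot_semiconj f g (H : R -> R) : {homo H : x y / x <= y} ->
  (forall x, H (x + 1) = H x + 1) -> (forall x, H (f x) = g (H x)) ->
  rot_num f = rot_num g.
Proof.
move=> mH H1 Hfg.
have HN n x : H (x + n%:R) = H x + n%:R.
  by elim: n => [|n IH]; rewrite ?addr0 // -natr1 !addrA H1 IH.
have Hz x z : H (x + z%:~R) = H x + z%:~R.
  case: z => n; first exact: HN.
  by rewrite NegzE mulrNz -[in RHS](subrK n.+1%:R x) HN addrK.
have Hi n : H (iter n f 0) = iter n g (H 0) by elim: n => //= n <-.
have Hx x : H 0 - 1 <= H x - x <= H 0 + 1.
  have [z /andP[z1 z2]] := floor_approx x.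
  have := mH _ _ z1; have := mH _ _ (ltW z2); rewrite H1.
  have := Hz 0 z; rewrite add0r => -> *; lra.
apply/eqP; rewrite eq_le; apply/andP; split.
  apply: (@rot_le_iter _ _ 0 (H 0) (1 - H 0)) => k.
  by have := Hx (iter k f 0); rewrite Hi; lra.
apply: (@rot_le_iter _ _ (H 0) 0 (H 0 + 1)) => k.
by have := Hx (iter k f 0); rewrite Hi; lra.
Qed.

Lemma rot_mulC f g : rot_num (f * g)%g = rot_num (g * f)%g.
Proof.
apply: (@rot_semiconj _ _ g); first by move=> x y; rewrite lh_le.
  exact: lh_comm.
by [].
Qed.

(** The function d is continuous and 1-periodic, so it has a minimum and a maximum. If it had a
    constant sign, f^(kn)(0) would drift linearly away from kz; hence it has a zero. *)
Lemma rot_rational_periodic f n z : (0 < n)%N -> rot_num f = z%:~R / n%:R ->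
  exists x, iter n f x = x + z%:~R.
Proof.
move=> n0 hf; pose d x := iter n f x - x - z%:~R.
have n0' : 0 < n%:R :> R by rewrite ltr0n.
have itc : continuous (iter n f).
  elim: (n) => [|k IH] x; first exact: cvg_id.
  by apply: (continuous_comp (IH x)); exact: lh_cont.
have dc : continuous d.
  move=> x; apply: cvgB; last exact: cvg_cst.
  by apply: cvgB; [exact: itc|exact: cvg_id].
have dw a b : {within `[a, b], continuous d}%classic.
  exact: continuous_subspaceT.
have dz x j : d (x + j%:~R) = d x by rewrite /d iter_addz; ring.
have kr k : k%:R * z%:~R = (k * n)%:R * rot_num f.
  by rewrite hf natrM -mulrA [n%:R * _]mulrC divfK ?gt_eqF.
suff : exists x, d x = 0 by case=> x hx; exists x; move: hx; rewrite /d; lra.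
have [a ain ha] := EVT_min ler01 (dw 0 1).
have [b bin hb] := EVT_max ler01 (dw 0 1).
have in01 x : exists y, y \in `[0, 1]%R /\ d y = d x.
  have [j /andP[j1 j2]] := floor_approx x; exists (x + (- j)%:~R); rewrite dz; split=> //.
  by rewrite in_itv /= mulrNz; apply/andP; split; lra.
have da x : d a <= d x by have [y [yin <-]] := in01 x; exact: ha.
have db x : d x <= d b by have [y [yin <-]] := in01 x; exact: hb.
have a0 : d a <= 0.
  apply: (@le_of_mul_bounded _ _ 1) => k.
  suff : k%:R * z%:~R + k%:R * d a <= iter (k * n) f 0.
    by have := rot_bound f (k * n); rewrite ler_norml kr => /andP[? ?]; lra.
  elim: k => [|k IH]; first by rewrite !mul0r addr0.
  rewrite mulSn iterD -natr1; move: IH (da (iter (k * n) f 0)); rewrite /d; lra.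
have b0 : 0 <= d b.
  apply: (@le_of_mul_bounded _ _ 1) => k.
  suff : iter (k * n) f 0 <= k%:R * z%:~R + k%:R * d b.
    by have := rot_bound f (k * n); rewrite ler_norml kr => /andP[? ?]; lra.
  elim: k => [|k IH]; first by rewrite !mul0r addr0.
  rewrite mulSn iterD -natr1; move: IH (db (iter (k * n) f 0)); rewrite /d; lra.
have [ab|ba] := leP a b.
  have [|x _ hx] := @IVT R d a b 0 ab (dw a b); last by exists x.
  by rewrite min_l ?max_r ?(le_trans a0) // a0.
have [|x _ hx] := @IVT R d b a 0 (ltW ba) (dw b a); last by exists x.
by rewrite min_r ?max_l ?(le_trans a0) // a0.
Qed.

End RotationNumber.

(** * Interpolation along periodic sequences *)

Section BilipschitzExtension.
Variable R : realType.
Implicit Types (K x y t s : R).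

(** Two-sided Lipschitz bounds for an increasing map taking x <= y to t <= s, symmetric under
    passing to the inverse map. *)
Definition bilip K x y t s := (y - x <= K * (s - t)) && (s - t <= K * (y - x)).

Lemma bilip_continuous K (F : R -> R) : 0 < K ->
  (forall x y, x <= y -> bilip K x y (F x) (F y)) -> continuous F.
Proof.
move=> K0 HF x; apply/cvgrPdist_lt => e e0.
have /cvgrPdist_lt/(_ _ (divr_gt0 e0 K0)) : id y @[y --> x] --> x by exact: cvg_id.
apply: filterS => y /=.
rewrite ltr_pdivlMr // => h.
have [xy|/ltW xy] := leP x y; have /andP[h1 h2] := HF _ _ xy.
  by rewrite distrC ger0_norm ?subr_ge0 // in h; rewrite ltr_norml; apply/andP; split; nra.
by rewrite ger0_norm ?subr_ge0 // in h; rewrite ltr_norml; apply/andP; split; nra.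
Qed.

Lemma bilip_homeo K (F : R -> R) : 0 < K ->
  (forall x y, x <= y -> bilip K x y (F x) (F y)) ->
  (forall x, F (x + 1) = F x + 1) ->
  exists f : lifted_homeo R, forall x, f x = F x.
Proof.
move=> K0 HF F1; have Fc := bilip_continuous K0 HF.
have surj y : exists x, F x = y.
  (* F expands distances at least by the factor 1/K, so the image of [-M, M] contains y. *)
  pose M := K * `|y - F 0|.
  have M0 : 0 <= M by apply: mulr_ge0 => //; exact: ltW.
  have NM : - M <= M by lra.
  have [||x _ hx] := @IVT R F (- M) M y NM; last by exists x.
    exact: continuous_subspaceT.
  have /andP[a1 a2] := HF _ _ NM.
  have /andP[b1 _] := HF 0 M M0.
  have /andP[c1 _] : bilip K (- M) 0 (F (- M)) (F 0) by apply: HF; rewrite oppr_le0.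
  have h1 : `|y - F 0| <= F M - F 0 by rewrite -(ler_pM2l K0) (le_trans _ b1) // subr0.
  have h2 : `|y - F 0| <= F 0 - F (- M) by rewrite -(ler_pM2l K0) (le_trans _ c1) // sub0r opprK.
  have h3 := ler_norm (y - F 0); have := ler_norm (- (y - F 0)); rewrite normrN => h4.
  have h5 := normr_ge0 (y - F 0).
  by rewrite min_l ?max_r; lra.
have [G HG] := choice surj.
have Flt x y : x < y -> F x < F y.
  move=> xy; have /andP[h _] := HF _ _ (ltW xy); rewrite -subr_gt0.
  by rewrite -(pmulr_rgt0 _ K0) (lt_le_trans _ h) // subr_gt0.
have Finj : injective F.
  by move=> x y e; have [/Flt|/Flt|//] := ltgtP x y; rewrite e ltxx.
have GF x : G (F x) = x by apply: Finj; rewrite HG.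
have Gc : continuous G.
  apply: (@bilip_continuous K) => // x y xy.
  have gxy : G x <= G y.
    by rewrite leNgt; apply/negP => /Flt; rewrite !HG ltNge xy.
  by have := HF _ _ gxy; rewrite /bilip !HG andbC.
by exists (@LiftedHomeo R F G GF HG Fc Gc Flt F1).
Qed.

(** A McShane extension keeping both bounds: a data point (t, s) contributes the minorant s + m(x -
    t), of slope K to the left of t and 1/K to the right, and F is the supremum of these. *)
Lemma bilip_extension K (S : set (R * R)) (t0 s0 : R) : 1 <= K -> S (t0, s0) ->
  (forall t s, S (t, s) -> S (t + 1, s + 1) /\ S (t - 1, s - 1)) ->
  (forall t s t' s', S (t, s) -> S (t', s') -> t <= t' -> bilip K t t' s s') ->
  exists f : lifted_homeo R, (forall t s, S (t, s) -> f t = s) /\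
    forall x y, x <= y -> bilip K x y (f x) (f y).
Proof.
move=> K1 S0 S1 SK; have K0 : 0 < K by rewrite (lt_le_trans ltr01).
have Ki : K^-1 <= K by rewrite (le_trans _ K1) // invf_le1.
pose m x := Num.min (K^-1 * x) (K * x).
have mM x : (m x <= K^-1 * x) /\ (m x <= K * x).
  by rewrite /m !ge_min !lexx orbT.
have md x e : 0 <= e -> (m x + K^-1 * e <= m (x + e)) /\ (m (x + e) <= m x + K * e).
  move=> e0; have : K^-1 * e <= K * e by rewrite ler_wpM2r.
  rewrite /m !mulrDr => he.
  have [h|h] := leP (K^-1 * x) (K * x);
    have [h'|h'] := leP (K^-1 * x + K^-1 * e) (K * x + K * e); split; lra.
pose B x := [set v | exists2 p, S p & v = p.2 + m (x - p.1)]%classic.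
pose F x := sup (B x).
have Sn n t s : S (t, s) -> S (t + n%:R, s + n%:R).
  move=> h; elim: n => [|n IH]; first by rewrite !addr0.
  by rewrite -natr1 !addrA; have [] := S1 _ _ IH.
(* A data point to the right of x bounds all minorants at x, which gives both finiteness of F and
   its values on the data. *)
have Bub t s x : S (t, s) -> x <= t -> ubound (B x) s.
  move=> hts xt _ [[t' s'] h' ->] /=; have [m1 m2] := mM (x - t').
  have [le|/ltW le] := leP t' t.
    have /andP[a _] := SK _ _ _ _ h' hts le.
    rewrite -lerBrDl (le_trans m1) // mulrC ler_pdivrMr // mulrC; lra.
  have /andP[_ a] := SK _ _ _ _ hts h' le.
  rewrite -lerBrDl (le_trans m2) //; nra.
have Bne x : (B x !=set0)%classic by exists (s0 + m (x - t0)), (t0, s0).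
have Bsup x : has_ubound (B x).
  exists (s0 + (Num.truncn (x - t0)).+1%:R); apply: (@Bub (t0 + (Num.truncn (x - t0)).+1%:R)).
    exact: Sn.
  by have := truncnS_gt (x - t0); lra.
have FS t s : S (t, s) -> F t = s.
  move=> h; apply/eqP; rewrite eq_le; apply/andP; split.
    by apply: ge_sup => //; exact: Bub h _.
  apply: ub_le_sup => //; exists (t, s) => //=.
  by rewrite subrr /m !mulr0 minxx addr0.
have FK x y : x <= y -> bilip K x y (F x) (F y).
  move=> xy; have yx0 : 0 <= y - x by rewrite subr_ge0.
  have e p : y - p = (x - p) + (y - x) by lra.
  apply/andP; split.
    suff : F x <= F y - K^-1 * (y - x).
      by move=> h; rewrite -(ler_pM2l (_ : 0 < K^-1)) ?invr_gt0 // mulKf ?gt_eqF //; lra.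
    apply: ge_sup => // _ [p hp ->].
    have : p.2 + m (y - p.1) <= F y by apply: ub_le_sup => //; exists p.
    rewrite e; have [] := md (x - p.1) _ yx0; lra.
  suff : F y <= F x + K * (y - x) by lra.
  apply: ge_sup => // _ [p hp ->].
  have : p.2 + m (x - p.1) <= F x by apply: ub_le_sup => //; exists p.
  rewrite e; have [] := md (x - p.1) _ yx0; lra.
have F1 x : F (x + 1) = F x + 1.
  apply/eqP; rewrite eq_le; apply/andP; split.
    apply: ge_sup => // _ [[t s] /S1[_ hp] ->] /=; rewrite -lerBlDr.
    apply: ub_le_sup => //; exists (t - 1, s - 1) => //=.
    by rewrite (_ : x - (t - 1) = x + 1 - t) 1?addrAC; last by lra.
  rewrite -lerBrDr; apply: ge_sup => // _ [[t s] /S1[hp _] ->] /=; rewrite lerBrDr.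
  apply: ub_le_sup => //; exists (t + 1, s + 1) => //=.
  by rewrite (_ : x + 1 - (t + 1) = x - t) 1?addrAC; last by lra.
have [f hf] := bilip_homeo K0 FK F1.
exists f; split=> [t s h|x y xy]; first by rewrite hf; exact: FS.
by rewrite !hf; exact: FK.
Qed.

End BilipschitzExtension.

(** * Periodic sequences and periodic orbits *)

Section PeriodicSequences.
Variable R : realType.
Implicit Types (f g : lifted_homeo R) (x y t s : int -> R) (n : nat) (i j : int).

(** The lift to the line of n points of the circle, numbered in cyclic order. *)
Definition pseq n x := (forall i, x i < x (i + 1)) /\ forall i, x (i + n%:Z) = x i + 1.

Lemma pseq_lt n x i j : pseq n x -> (x i < x j) = (i < j).
Proof.
case=> xl _; have H a k : x a < x (a + k.+1%:Z).
  elim: k => [|k IH]; first exact: xl.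
  by rewrite (lt_trans IH) // -[k.+2]addn1 PoszD addrA.
have Hlt a b : a < b -> x a < x b.
  move=> ab; have -> : b = a + (`|b - a|.-1.+1)%:Z by lia.
  exact: H.
apply/idP/idP => [|/Hlt//]; apply: contraTT; rewrite -!leNgt le_eqVlt.
by case/predU1P=> [->//|/Hlt/ltW].
Qed.

Lemma pseq_le n x i j : pseq n x -> (x i <= x j) = (i <= j).
Proof. by move=> px; rewrite !leNgt (pseq_lt _ _ px). Qed.

Lemma pseq_addz n x i j : pseq n x -> x (i + n%:Z * j) = x i + j%:~R.
Proof.
case=> _ x1; have H k a : x (a + n%:Z * k%:Z) = x a + k%:R.
  elim: k => [|k IH]; first by rewrite mulr0 !addr0.
  by rewrite -natr1 -addn1 PoszD mulrDr mulr1 addrA x1 IH addrA.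
case: j => k; first exact: H.
by rewrite NegzE mulrNz -[in RHS](subrK (n%:Z * k.+1%:Z) i) H addrK mulrN.
Qed.

Lemma pseq_locate n x (v : R) : (0 < n)%N -> pseq n x ->
  exists i, x i <= v < x (i + 1).
Proof.
move=> n0 px; have [z /andP[z1 z2]] := floor_approx (v - x 0).
pose u := v - z%:~R.
suff [i hi] : exists i, x i <= u < x (i + 1).
  exists (i + n%:Z * z); rewrite addrAC !(pseq_addz _ _ px); move: hi; rewrite /u; lra.
have h0 : x 0 <= u by rewrite /u; lra.
have : u < x n%:Z by rewrite -[n%:Z]add0r; case: px => _ ->; rewrite /u; lra.
elim: (n) => [|k IH] hu; first by move: hu; rewrite ltNge h0.
have [/IH//|h] := ltP u (x k).
by exists k%:Z; rewrite h /= -[in X in _ < X](PoszD k 1) addn1.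
Qed.

Lemma pseq_bound n t s : (0 < n)%N -> pseq n t -> pseq n s ->
  exists2 K : R, 1 <= K & forall i, t (i + 1) - t i <= K * (s (i + 1) - s i).
Proof.
move=> n0 pt ps.
have [K K1 HK] : exists2 K : R, 1 <= K &
    forall k, (k < n)%N -> t (k%:Z + 1) - t k <= K * (s (k%:Z + 1) - s k).
  elim: (n) => [|m [K K1 HK]]; first by exists 1.
  exists (Num.max K ((t (m%:Z + 1) - t m) / (s (m%:Z + 1) - s m))).
    by rewrite le_max K1.
  move=> k; have sk : 0 < s (k%:Z + 1) - s k by rewrite subr_gt0; case: ps.
  rewrite ltnS leq_eqVlt => /predU1P[e|/HK h].
    by subst k; rewrite -ler_pdivrMr // le_max lexx orbT.
  by rewrite (le_trans h) // ler_pM2r // le_max lexx.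
exists K => // i; have e : i = (absz (i %% n)%Z)%:Z + n%:Z * (i %/ n)%Z.
  by have := divz_eq i n; have := modz_ge0 i (_ : n%:Z != 0); lia.
have h : (absz (i %% n)%Z < n)%N.
  by have := modz_ge0 i (_ : n%:Z != 0); have := ltz_pmod i (_ : 0 < n%:Z); lia.
rewrite e addrAC !(pseq_addz _ _ pt) !(pseq_addz _ _ ps).
by have := HK _ h; set K' := K * _; set K2 := K * _; rewrite /K' /K2; lra.
Qed.

Lemma pseq_telescope n K t s i j : 0 <= K -> pseq n t -> pseq n s ->
  (forall i, t (i + 1) - t i <= K * (s (i + 1) - s i)) -> i <= j ->
  t j - t i <= K * (s j - s i).
Proof.
move=> K0 pt ps H ij; have -> : j = i + (`|j - i|%N)%:Z by lia.
elim: `|_|%N => [|k IH]; first by rewrite addr0 !subrr mulr0.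
have := H (i + k%:Z); rewrite -addrA -PoszD addn1; lra.
Qed.

(** By periodicity only finitely many ratios of gaps occur, so the pairs (t i, s i) are bilipschitz
    data. *)
Lemma interpolation n t s : (0 < n)%N -> pseq n t -> pseq n s ->
  exists f, forall i, f (t i) = s i.
Proof.
move=> n0 pt ps; have [K K1 HK] := pseq_bound n0 pt ps.
have [L L1 HL] := pseq_bound n0 ps pt.
pose S := [set p : R * R | exists i, p = (t i, s i)]%classic.
have M1 : 1 <= Num.max K L by rewrite le_max K1.
have [||||f [Hf _]] := @bilip_extension R (Num.max K L) S (t 0) (s 0) => //.
- by exists 0.
- move=> _ _ [i [-> ->]]; case: (pt) => _ t1; case: (ps) => _ s1.
  split; [exists (i + n%:Z)|exists (i - n%:Z)]; first by rewrite t1 s1.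
  by rewrite -[in t i](subrK n%:Z i) -[in s i](subrK n%:Z i) t1 s1 !addrK.
- move=> _ _ _ _ [i [-> ->]] [j [-> ->]]; rewrite (pseq_le _ _ pt) => ij.
  have h1 := pseq_telescope (le_trans ler01 K1) pt ps HK ij.
  have h2 := pseq_telescope (le_trans ler01 L1) ps pt HL ij.
  have t0 : 0 <= t j - t i by rewrite subr_ge0 (pseq_le _ _ pt).
  have s0 : 0 <= s j - s i by rewrite subr_ge0 (pseq_le _ _ ps).
  apply/andP; split; [rewrite (le_trans h1) //|rewrite (le_trans h2) //];
    by rewrite ler_wpM2r // le_max lexx ?orbT.
by exists f => i; apply: Hf; exists i.
Qed.

Lemma int_shift_ind (P : int -> Prop) :
  P 0 -> (forall i, P i <-> P (i + 1)) -> forall i, P i.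
Proof.
move=> P0 PS; elim=> [//|n IH|n IH]; first by rewrite -addn1 PoszD; exact: (PS n).1.
by apply: (PS _).2; have -> : - n.+1%:Z + 1 = - n%:Z by lia.
Qed.

(** If u k = v n + 1, then S = f^u - v satisfies S^n a = a + 1 and S^k a = f a on the periodic point
    a. Hence x i = S^i a lists the orbit and its translates in increasing order. *)
Lemma periodic_orbit_nat f (k n : nat) : (0 < n)%N -> (0 < k)%N -> coprime k n ->
  rot_num f = k%:R / n%:R ->
  exists2 x, pseq n x & forall i, f (x i) = x (i + k%:Z).
Proof.
move=> n0 k0 /(coprimeP _ k0) [[u v] /= uv] hf.
have [a ha] := @rot_rational_periodic R f n k n0 hf.
have uv' : (u * k = v * n + 1)%N by lia.
pose S (y : R) := iter u f y - v%:R.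
pose S' (y : R) := iter u (lh_inv f) (y + v%:R).
have itK m : cancel (iter m f) (iter m (lh_inv f)).
  by elim: m => // m IH y; rewrite iterSr [iter m.+1 f y]iterS lh_funK IH.
have itK' m : cancel (iter m (lh_inv f)) (iter m f).
  by elim: m => // m IH y; rewrite iterSr [iter m.+1 (lh_inv f) y]iterS lh_invK IH.
have SK : cancel S S' by move=> y; rewrite /S /S' subrK itK.
have SK' : cancel S' S by move=> y; rewrite /S /S' itK' addrK.
have Sinj := can_inj SK.
have Slt (y z : R) : (S y < S z) = (y < z) by rewrite /S ltrD2r iter_lt.
have addn m (y : R) l : iter m f (y + l%:R) = iter m f y + l%:R.
  exact: (@iter_addz R f m y l).
have S1 (y : R) : S (y + 1) = S y + 1 by rewrite /S (addn u y 1%N) addrAC.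
have Sf (y : R) : S (f y) = f (S y).
  by rewrite /S -iterSr iterS -[in RHS](addrK v%:R (f _)) -lh_addn subrK.
have iterS_ m (y : R) : iter m S y = iter (m * u) f y - (m * v)%:R.
  elim: m => [|m IH]; first by rewrite subr0.
  rewrite iterS IH /S mulSn iterD mulSn natrD.
  have -> : iter u f (iter (m * u) f y - (m * v)%:R) = iter u f (iter (m * u) f y) - (m * v)%:R.
    by rewrite -[in RHS](subrK (m * v)%:R (iter (m * u) f y)) addn addrK.
  by rewrite opprD addrA addrAC.
have itp l : iter (l * n) f a = a + (l * k)%:R.
  by rewrite (@iter_period R f n k a l ha) natrM.
have Sn : iter n S a = a + 1.
  rewrite iterS_ mulnC itp uv' mulnC -[(_ + 1)%N]addnC natrD; lra.
have Sk : iter k S a = f a.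
  rewrite iterS_ mulnC uv' addn1 iterS itp lh_addn mulnC addrK //.
pose x i := match i with Posz m => iter m S a | Negz m => iter m.+1 S' a end.
have xS i : x (i + 1) = S (x i).
  case: i => [m|m]; first by rewrite -PoszD addn1.
  have -> : Negz m + 1 = - m%:Z by lia.
  by case: m => [|m]; rewrite /x [iter _.+1 S' a in RHS]iterS SK'.
have xSn m i : x (i + m%:Z) = iter m S (x i).
  elim: m => [|m IH]; first by rewrite addr0.
  by rewrite -addn1 PoszD addrA xS IH addn1.
have a_lt : a < S a.
  rewrite ltNge; apply/negP => h.
  have : forall m, iter m S a <= a.
    elim=> // m IH; rewrite iterS (le_trans _ h) //.
    by move: IH; rewrite !leNgt Slt.
  by move=> /(_ n); rewrite Sn; lra.
exists x; first split.
- apply: int_shift_ind; first by rewrite add0r (xS 0).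
  by move=> i; rewrite !xS Slt.
- apply: int_shift_ind; first by rewrite xSn.
  move=> i; rewrite addrAC !xS; split=> [->|]; first by rewrite S1.
  by rewrite -S1 => /Sinj.
- apply: int_shift_ind; first by rewrite xSn Sk.
  move=> i; rewrite addrAC !xS -Sf; split=> [->//|]; exact: Sinj.
Qed.

Lemma periodic_orbit f (k : int) n : (0 < n)%N -> coprime `|k| n ->
  rot_num f = k%:~R / n%:R ->
  exists2 x, pseq n x & forall i, f (x i) = x (i + k).
Proof.
(* Composing with an integer translation makes the numerator positive; on the orbit this only shifts
   indices by a multiple of n. *)
move=> n0 kn hf; pose N := (`|k| + 1)%N.
have k'0 : 0 < k + (n * N)%:Z by rewrite /N; nia.
pose k' := absz (k + (n * N)%:Z); have ek' : k'%:Z = k + (n * N)%:Z by rewrite /k'; lia.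
have [||||x px hx] := @periodic_orbit_nat (lh_transl N%:R * f)%g k' n => //.
- by rewrite /k'; lia.
- suff -> : coprime k' n = coprimez (k + (n * N)%:Z) n.
    by rewrite PoszM /coprimez addrC gcdzC mulrC gcdzMDl gcdzC.
  by rewrite /k' /coprimez /gcdz /=.
- rewrite rot_transl_n hf -[k'%:R]/(k'%:~R) ek' intrD mulrDl; congr (_ + _).
  by rewrite -[_%:~R]/((n * N)%:R) natrM mulrAC mulfV ?mul1r // pnatr_eq0 -lt0n.
exists x => // i; have := hx i; rewrite transl_mulE ek' addrA PoszM (pseq_addz _ _ px).
exact: addIr.
Qed.

End PeriodicSequences.

(** * Local constancy from the right *)

Section PositiveWords.
Variable R : realType.
Implicit Types (phi psi : bool -> lifted_homeo R) (s t : seq bool).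

(** The last letter of s is applied first. *)
Definition pact phi s : lifted_homeo R := foldr (fun c h => phi c * h)%g 1%g s.

Lemma pact_cat phi s t : pact phi (s ++ t) = (pact phi s * pact phi t)%g.
Proof.
by elim: s => [|c s IH] /=; rewrite ?mul1g // IH mulgA.
Qed.

Lemma pact_le phi psi s : (forall c x, phi c x <= psi c x) ->
  forall x, pact phi s x <= pact psi s x.
Proof.
move=> le; elim: s => //= c s IH x.
by rewrite (le_trans (le _ _)) // lh_le.
Qed.

Lemma pact_nseq phi c m x : pact phi (nseq m c) x = iter m (phi c) x.
Proof. by elim: m => //= m ->. Qed.

End PositiveWords.

(** * Comparing a word before and after the orbits are broken *)

Section ArcComparison.
Variables (R : realType) (m : nat) (f F : bool -> lifted_homeo R) (p : bool -> int).
(** Here f are the given maps and F those with broken orbits. The arc l of c runs from a c l to b c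
    i l and is longer for larger i. The map f c takes arc l to arc l + p c while i grows by one, and
    F c sends b c 0 l beyond the image under f c of the start of the next arc. *)
Variables (a : bool -> int -> R) (b : bool -> nat -> int -> R).
Hypothesis a_locate : forall c v, exists l, a c l <= v < a c (l + 1).
Hypothesis ab : forall c l, a c l <= b c 0%N l.
Hypothesis b_nondecr : forall c i j l, (i <= j)%N -> b c i l <= b c j l.
Hypothesis f_b : forall c i l, f c (b c i l) <= b c i.+1 (l + p c).
Hypothesis f_a : forall c l, a c (l + p c) <= f c (a c l).
Hypothesis F_b : forall c l, f c (a c (l + 1)) <= F c (b c 0%N l).
Hypothesis b_a : forall c l, b c 0%N l <= a c (l + 1).
Hypothesis b_bound : forall c l, b c m l <= a c l + 1.
Hypothesis separated : forall c l l',
  b c m l < a (~~ c) l' \/ b (~~ c) m l' < a c l.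

(* [Z] may fall behind [z] only inside one of the arcs around the broken orbit of
   the letter [c] applied last; [i] bounds how often [c] has just been applied. *)
Let follows (c : bool) (i : nat) (Z z : R) : Prop :=
  z <= Z \/ exists l, a c l <= Z /\ z <= b c i l.

Let follows_le c i j Z z : (i <= j)%N -> follows c i Z z -> follows c j Z z.
Proof.
move=> ij [|[l [h1 h2]]]; [by left|right; exists l; split=> //].
exact: le_trans h2 (b_nondecr _ _ ij).
Qed.

Let F_a c l : f c (a c l) <= F c (a c l).
Proof.
have := F_b c (l - 1); rewrite subrK => h; apply: le_trans h _.
by rewrite lh_le; have := b_a c (l - 1); rewrite subrK.
Qed.

(** If Z is beyond b c 0 l, the jump of F overtakes the image of the start of the next arc, hence
    that of z. Otherwise both points lie in arc l. *)
Let follows_ahead c Z z : z <= Z -> follows c 1 (F c Z) (f c z).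
Proof.
move=> zZ; have [l /andP[l1 l2]] := a_locate c z.
have [Zb|/ltW Zb] := leP (b c 0%N l) Z.
  left; apply: le_trans (_ : f c (a c (l + 1)) <= _); first by rewrite lh_le ltW.
  by apply: le_trans (F_b c l) _; rewrite lh_le.
right; exists (l + p c); split.
  apply: le_trans (f_a c l) _; apply: le_trans (F_a c l) _.
  by rewrite lh_le (le_trans l1).
by apply: le_trans (f_b c 0 l); rewrite lh_le (le_trans zZ).
Qed.

Let follows_same c i Z z : follows c i Z z -> follows c i.+1 (F c Z) (f c z).
Proof.
case=> [h|[l [h1 h2]]]; first exact: (follows_le (ltn0Sn i) (follows_ahead c h)).
right; exists (l + p c); split; last by apply: le_trans (f_b c i l); rewrite lh_le.
by apply: le_trans (f_a c l) _; apply: le_trans (F_a c l) _; rewrite lh_le.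
Qed.

(** By separation, Z is already beyond the last arc of the other letter that starts before a c l,
    while z has not passed the start of the following one. The jump of F makes up the whole
    delay. *)
Let follows_other c i Z z : (i <= m)%N ->
  follows c i Z z -> follows (~~ c) 1 (F (~~ c) Z) (f (~~ c) z).
Proof.
move=> im [/follows_ahead//|[l [h1 h2]]]; left.
have zb := le_trans h2 (b_nondecr c l im).
have abm c' l' : a c' l' <= b c' m l' by rewrite (le_trans (ab _ _)) ?b_nondecr.
have [l' /andP[l1 l2]] := a_locate (~~ c) (a c l).
have Zb : b (~~ c) 0%N l' <= Z.
  apply: le_trans h1; apply: (le_trans (b_nondecr _ _ (leq0n m))).
  have [h|/ltW//] := separated c l l'.
  by have := lt_le_trans h l1; rewrite ltNge abm.
have za : z <= a (~~ c) (l' + 1).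
  have [/ltW h|h] := separated c l (l' + 1); first exact: le_trans zb h.
  by have := lt_trans l2 (le_lt_trans (abm _ _) h); rewrite ltxx.
apply: le_trans (_ : F (~~ c) (b (~~ c) 0%N l') <= _); last by rewrite lh_le.
by apply: le_trans (F_b _ _); rewrite lh_le.
Qed.

(** A change of letter resets the index to 1, so after a nonconstant word the index no longer
    depends on its initial value. *)
Let follows_word s c i Z z : (i + size s <= m)%N -> follows c i Z z ->
  exists j, [/\ follows (head c s) j (pact F s Z) (pact f s z), (j <= i + size s)%N &
    ~~ constant s -> (j <= size s)%N].
Proof.
elim: s => [|x s IH] im H; first by exists i; split=> //; rewrite addn0.
have [|j [Hj j1 j2]] := IH _ H; first by move: im => /=; lia.
have jm : (j <= m)%N by move: im => /=; lia.
have [e|/negbTE ne] := eqVneq x (head c s).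
  exists j.+1; split; first by rewrite /= e; exact: follows_same.
    by rewrite /= addnS ltnS.
  move=> nc; rewrite ltnS; apply: j2; apply: contra nc.
  by case: (s) e => //= y s' ->; rewrite eqxx.
exists 1%N; split => //=; last by lia.
have -> : x = ~~ head c s by case: (x) (head c s) ne => [] [].
exact: follows_other Hj.
Qed.

(** Each copy of the word starts with an index at most [size s] and adds at most [size s], whence
    the bound on m. A delay within one arc is at most 1 and is invisible to the rotation number. *)
Lemma arc_comparison s : ~~ constant s -> (2 * size s <= m)%N ->
  rot_num (pact f s) <= rot_num (pact F s).
Proof.
move=> nc sm; apply: (@rot_le_iter _ _ _ 0 0 1) => k.
suff [c [i [im [|[l [h1 h2]]]]]] : exists c i, (i <= size s)%N /\
    follows c i (iter k (pact F s) 0) (iter k (pact f s) 0).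
- by move=> h; rewrite (le_trans h) ?lerDl.
- have := le_trans h2 (b_nondecr c l (_ : i <= m)%N); have := b_bound c l.
  have im' : (i <= m)%N by lia.
  move=> h3 /(_ im') h4; lra.
elim: k => [|k [c [i [im H]]]]; first by exists true, 0%N; split=> //; left.
have im2 : (i + size s <= m)%N by move: im sm; clear; lia.
have [j [Hj j1 j2]] := @follows_word s c i _ _ im2 H.
by exists (head c s), j; split; [exact: j2|].
Qed.

End ArcComparison.

(** If every pair were obstructed, selecting an obstruction would be injective: one of type A is
    determined by (j', l), one of type B by (j, l). Then J^2 <= J (q + q'). *)
Lemma pair_pigeonhole (J q q' : nat) (A : 'I_J -> 'I_J -> 'I_q -> Prop)
    (B : 'I_J -> 'I_J -> 'I_q' -> Prop) :
  (forall j1 j2 j' l, A j1 j' l -> A j2 j' l -> j1 = j2) ->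
  (forall j j1 j2 l, B j j1 l -> B j j2 l -> j1 = j2) ->
  (q + q' < J)%N ->
  exists j j', (forall l, ~ A j j' l) /\ (forall l, ~ B j j' l).
Proof.
move=> HA HB qJ; apply: contrapT => H.
have sel (u : 'I_J * 'I_J) : exists v : ('I_J * 'I_q) + ('I_J * 'I_q'),
    match v with
    | inl w => w.1 = u.2 /\ A u.1 u.2 w.2
    | inr w => w.1 = u.1 /\ B u.1 u.2 w.2
    end.
  case: u => j j'; apply: contrapT => H'; apply: H; exists j, j'; split=> l h; apply: H'.
    by exists (inl (j', l)).
  by exists (inr (j, l)).
have [h hh] := choice sel.
have /leq_card : injective h.
  move=> [j1 j1'] [j2 j2'] e; move: (hh (j1, j1')) (hh (j2, j2')); rewrite e.
  case: (h (j2, j2')) => [[u l]|[u l]] /= [e1 h1] [e2 h2]; subst.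
    by rewrite (HA _ _ _ _ h1 h2).
  by rewrite (HB _ _ _ _ h1 h2).
rewrite card_sum !card_prod !card_ord; nia.
Qed.

(** * Clusters of an orbit and maps breaking it *)

Section BrokenOrbits.
Variables (R : realType).

(* When [k q = p n + 1], the indices [cluster_idx n q l + o] pick from an orbit of rotation
   number [k/n] a cluster of [q] points per turn, which is almost invariant. *)
Definition cluster_idx (n q : nat) (l : int) : int := ((l * n%:Z) %/ q%:Z)%Z.

Lemma cluster_idx_period n q (l z : int) : (0 < q)%N ->
  cluster_idx n q (l + q%:Z * z) = cluster_idx n q l + n%:Z * z.
Proof.
move=> q0; rewrite /cluster_idx.
have -> : (l + q%:Z * z) * n%:Z = (n%:Z * z) * q%:Z + l * n%:Z by ring.
by rewrite divzMDl 1?addrC //; lia.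
Qed.

(** Here l n + k q = (l + p) n + 1, and adding 1 before the division by q raises the floor by at
    most 1. *)
Lemma cluster_idx_shift n q (k p l : int) : (0 < q)%N -> k * q%:Z = p * n%:Z + 1 ->
  cluster_idx n q (l + p) <= cluster_idx n q l + k <= cluster_idx n q (l + p) + 1.
Proof.
move=> q0 kq; rewrite /cluster_idx.
have -> : (l + p) * n%:Z = k * q%:Z + (l * n%:Z - 1) by rewrite kq; ring.
have q0' : q%:Z != 0 by lia.
rewrite divzMDl //.
have h1 : ((l * n%:Z - 1) %/ q%:Z)%Z <= ((l * n%:Z) %/ q%:Z)%Z.
  by apply: lez_pdiv2r; lia.
have h2 : ((l * n%:Z) %/ q%:Z)%Z <= 1 + ((l * n%:Z - 1) %/ q%:Z)%Z.
  by rewrite -divzMDl //; apply: lez_pdiv2r; lia.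
move: h1 h2; set u := divz _ _; set v := divz _ _; lia.
Qed.

Lemma cluster_idx_gap n q (w : nat) (l : int) : (0 < q)%N -> (q * w <= n)%N ->
  cluster_idx n q l + w%:Z <= cluster_idx n q (l + 1).
Proof.
move=> q0 qw; rewrite /cluster_idx.
have q0' : q%:Z != 0 by lia.
rewrite addrC -divzMDl // mulrDl mul1r; apply: lez_pdiv2r; first lia.
by rewrite addrC lerD2l -PoszM lez_nat mulnC.
Qed.

Lemma cluster_idx_le n q (w : nat) (l l' : int) : (0 < q)%N -> (q * w <= n)%N -> l < l' ->
  cluster_idx n q l + w%:Z <= cluster_idx n q l'.
Proof.
move=> q0 qw ll'; have -> : l' = l + 1 + (`|(l' - l - 1)%R|%N)%:Z by lia.
elim: `|_|%N => [|d IH]; first by rewrite addr0 cluster_idx_gap.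
apply: (le_trans IH); rewrite -addn1 PoszD addrA.
by have := @cluster_idx_gap n q 0 (l + 1 + d%:Z) q0; rewrite muln0 addr0; apply.
Qed.

(** Interpolation with two points per cluster index: those at offset 2 form an orbit of rotation
    number p/q, and those at offset 3 are sent to offset 1, just short of the next point of this
    orbit. Even and odd indices of t and s encode the two kinds. *)
Lemma broken_orbit_map n q (k p o : int) (x : int -> R) : (0 < q)%N -> (4 * q <= n)%N ->
  k * q%:Z = p * n%:Z + 1 -> pseq n x ->
  exists F : lifted_homeo R, rot_num F = p%:~R / q%:R /\
    forall l, F (x (cluster_idx n q l + o + 3)) = x (cluster_idx n q (l + p + 1) + o + 1).
Proof.
move=> q0 qn kq px; set I := cluster_idx n q.
have I1 (l : int) : I l + 4 <= I (l + 1) by apply: (@cluster_idx_gap n q 4) => //; lia.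
have Iq (l : int) : I (l + q%:Z) = I l + n%:Z.
  by have := @cluster_idx_period n q l 1 q0; rewrite !mulr1.
clearbody I.
pose half (i : int) := (i %/ 2)%Z; pose par (i : int) := (i %% 2)%Z.
have ev i : i = half i * 2 + par i by exact: divz_eq.
have par01 i : par i = 0 \/ par i = 1.
  by have := modz_ge0 i (isT : 2%:Z != 0); have := ltz_pmod i (isT : 0 < 2%:Z); rewrite /par; lia.
have half0 (l : int) : half (l * 2) = l by have := ev (l * 2); have := par01 (l * 2); lia.
have half1 (l : int) : half (l * 2 + 1) = l by have := ev (l * 2 + 1); have := par01 (l * 2 + 1); lia.
have par0 (l : int) : par (l * 2) = 0 by have := ev (l * 2); have := par01 (l * 2); lia.
have par1 (l : int) : par (l * 2 + 1) = 1 by have := ev (l * 2 + 1); have := par01 (l * 2 + 1); lia.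
pose t i := x (I (half i) + o + 2 + par i).
pose s i := if par i == 0 then x (I (half i + p) + o + 2) else x (I (half i + p + 1) + o + 1).
have cases (P : int -> Prop) : (forall l, P (l * 2)) -> (forall l, P (l * 2 + 1)) -> forall i, P i.
  by move=> h0 h1 i; rewrite (ev i); case: (par01 i) => ->; rewrite ?addr0.
have x1 : forall i, x (i + n%:Z) = x i + 1 by case: px.
have succ (l : int) : l * 2 + 1 + 1 = (l + 1) * 2 by lia.
have per0 (l : int) : l * 2 + (2 * q)%:Z = (l + q%:Z) * 2 by lia.
have per1 (l : int) : l * 2 + 1 + (2 * q)%:Z = (l + q%:Z) * 2 + 1 by lia.
have pt : pseq (2 * q) t.
  split; apply: cases => l; rewrite /t.
  - by rewrite half0 par0 half1 par1 (pseq_lt _ _ px); lia.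
  - by rewrite succ half0 par0 half1 par1 (pseq_lt _ _ px); have := I1 l; lia.
  - rewrite per0 !half0 !par0 Iq -x1; congr x; lia.
  - rewrite per1 !half1 !par1 Iq -x1; congr x; lia.
have ps : pseq (2 * q) s.
  split; apply: cases => l; rewrite /s.
  - rewrite half0 par0 half1 par1 /= (pseq_lt _ _ px); have := I1 (l + p).
    by move: (I (l + p)) (I (l + p + 1)) => A B; lia.
  - rewrite succ half0 par0 half1 par1 /= (pseq_lt _ _ px).
    by rewrite (addrAC l 1); move: (I (l + p + 1)) => A; lia.
  - rewrite per0 !half0 !par0 /= (addrAC l) Iq -x1; congr x; move: (I _) => A; lia.
  - rewrite per1 !half1 !par1 /= (addrAC l) (addrAC (l + p)) Iq -x1; congr x; move: (I _) => A; lia.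
have q2 : (0 < 2 * q)%N by lia.
have [F HF] := interpolation q2 pt ps.
exists F; split.
  have Ft l : F (t (l * 2)) = t ((l + p) * 2).
    by rewrite HF // /s /t !half0 !par0 /= addr0.
  apply: (@rot_period R F q p (t 0) q0).
  have it N : iter N F (t 0) = t ((N%:Z * p) * 2).
    by elim: N => [|N IH]; rewrite ?mul0r // iterS IH Ft; congr (t (_ * 2)); lia.
  rewrite it -[in RHS](mul0r (2 : int)) -(pseq_addz _ _ pt); congr t; lia.
move=> l; have := HF (l * 2 + 1); rewrite /s /t half1 par1 /=.
by rewrite (_ : _ + 2 + 1 = I l + o + 3) //; lia.
Qed.

(** A solution (k, n) of the Bezout equation may be shifted by any multiple of (p, q), which makes n
    large. *)
Lemma rational_successor (p : int) (q B : nat) : (0 < q)%N -> coprime `|p| q ->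
  exists (k : int) (n : nat), (B <= n)%N /\ k * q%:Z = p * n%:Z + 1.
Proof.
move=> q0 pq; have [u [v uv]] := Bezoutz p q%:Z.
have uv1 : u * p + v * q%:Z = 1 by rewrite uv /gcdz; move: pq; rewrite /coprime => /eqP ->.
pose t := (`|u|%N + B)%N; have h : 0 <= q%:Z * t%:Z - u by rewrite /t; nia.
exists (v + t%:Z * p), `|(q%:Z * t%:Z - u)%R|%N; split; first by rewrite /t; nia.
by rewrite gez0_abs //; lia.
Qed.

Lemma rational_from_above (p : bool -> int) (q : bool -> nat) (s : seq bool) :
  (forall c, (0 < q c)%N) -> (forall c, coprime `|p c| (q c)) -> ~~ constant s ->
  exists (k : bool -> int) (n : bool -> nat),
    (forall c, (0 < n c)%N /\ k c * (q c)%:Z = p c * (n c)%:Z + 1) /\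
    forall phi : bool -> lifted_homeo R,
      (forall c, rot_num (phi c) = (k c)%:~R / (n c)%:R) ->
      exists psi : bool -> lifted_homeo R,
        (forall c, rot_num (psi c) = (p c)%:~R / (q c)%:R) /\
        rot_num (pact phi s) <= rot_num (pact psi s).
Proof.
(* An arc takes M indices: offsets 0 to 3 for the broken orbit, then room for [2 * size s]
   lengthenings. J exceeds the number of arcs of both letters per turn, and n >= q J M lets J
   disjoint families of arcs fit. *)
move=> q0 pq nc; pose M := (2 * size s + 4)%N; pose J := (q true + q false).+1.
have /choice[k /choice[n kn]] c : exists (k : int) (n : nat),
    (q c * (J * M) <= n)%N /\ k * (q c)%:Z = p c * n%:Z + 1.
  exact: rational_successor.
have n0 c : (0 < n c)%N.
  by have [h _] := kn c; apply: leq_trans h; rewrite !muln_gt0 q0 /M addnS.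
exists k, n; split; first by move=> c; split=> //; have [] := kn c.
move=> phi rphi.
have kq c : k c * (q c)%:Z = p c * (n c)%:Z + 1 by have [] := kn c.
have nJ c : (q c * (J * M) <= n c)%N by have [] := kn c.
have n4 c : (q c * M <= n c)%N.
  by apply: leq_trans (nJ c); rewrite leq_mul2l; apply/orP; right; rewrite /J mulSn leq_addr.
have cop c : coprime `|k c| (n c).
  rewrite /coprime -dvdn1.
  have : (gcdz (k c) (n c)%:Z %| k c * (q c)%:Z - p c * (n c)%:Z)%Z.
    by apply: rpredB; [rewrite dvdz_mulr ?dvdz_gcdl|rewrite dvdz_mull ?dvdz_gcdr].
  by rewrite kq addrAC subrr add0r.
have /choice[x hx] c : exists x : int -> R, pseq (n c) x /\
    forall i, phi c (x i) = x (i + k c).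
  by have [x px hx] := periodic_orbit (n0 c) (cop c) (rphi c); exists x.
have px c : pseq (n c) (x c) by have [] := hx c.
have xk c i : phi c (x c i) = x c (i + k c) by have [] := hx c.
pose I c l := cluster_idx (n c) (q c) l.
pose lo c (j : nat) l := x c (I c l + (j * M)%:Z).
pose hi c (j : nat) l := x c (I c l + (j * M)%:Z + (M.-1)%:Z).
have Iz c l z : I c (l + (q c)%:Z * z) = I c l + (n c)%:Z * z.
  exact: cluster_idx_period.
have loz c j l z : lo c j (l + (q c)%:Z * z) = lo c j l + z%:~R.
  by rewrite /lo Iz addrAC (pseq_addz _ _ (px c)).
have hiz c j l z : hi c j (l + (q c)%:Z * z) = hi c j l + z%:~R.
  by rewrite /hi Iz 2!(addrAC _ (_ * z)) (pseq_addz _ _ (px c)).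
have uniq_arc c (j1 j2 : 'I_J) l1 l2 v :
    lo c j1 l1 <= v <= hi c j1 l1 -> lo c j2 l2 <= v <= hi c j2 l2 -> j1 = j2.
  move=> /andP[a1 b1] /andP[a2 b2].
  have := le_trans a1 b2; have := le_trans a2 b1.
  rewrite /lo /hi !(pseq_le _ _ (px c)) => e1 e2; apply: val_inj => /=.
  have gap l l' : l < l' -> I c l + (J * M)%:Z <= I c l'.
    by move=> ll'; apply: cluster_idx_le.
  have M0 : (0 < M)%N by rewrite /M; lia.
  have := ltn_ord j1; have := ltn_ord j2; move: (gap l1 l2) (gap l2 l1).
  clear -e1 e2 M0; case: (ltgtP l1 l2) e1 e2 => [_|_|->]; move: (I c _) => A.
  - move: (I c _) => B e1 e2 /(_ isT) h _ h1 h2; nia.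
  - move: (I c _) => B e1 e2 _ /(_ isT) h h1 h2; nia.
  - move=> e1 e2 _ _ h1 h2; nia.
(* An arc of one letter starting inside an arc of the other is the obstruction. Arcs are invariant
   under integer translations, so one turn of indices suffices. *)
pose PA (j j' : 'I_J) (l' : 'I_(q false)) :=
  exists l, lo true j l <= lo false j' l'%:Z <= hi true j l.
pose PB (j j' : 'I_J) (l : 'I_(q true)) :=
  exists l', lo false j' l' <= lo true j l%:Z <= hi false j' l'.
have [||| j [j' [nA nB]]] := @pair_pigeonhole J (q false) (q true) PA PB.
- by move=> j1 j2 j' l [l1 h1] [l2 h2]; exact: uniq_arc h1 h2.
- by move=> j j1 j2 l [l1 h1] [l2 h2]; exact: uniq_arc h1 h2.
- by rewrite addnC.
have red c (l : int) : exists (l0 : 'I_(q c)) z, l = l0%:Z + (q c)%:Z * z.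
  have qc : (q c)%:Z != 0 by have := q0 c; lia.
  have h0 := modz_ge0 l qc.
  have h1 : (l %% (q c)%:Z)%Z < (q c)%:Z by apply: ltz_pmod; have := q0 c; lia.
  have h2 : (`|(l %% (q c)%:Z)%Z|%N < q c)%N by lia.
  exists (Ordinal h2), (l %/ (q c)%:Z)%Z => /=; rewrite gez0_abs //.
  by rewrite {1}(divz_eq l (q c)%:Z) addrC mulrC.
pose o c := ((if c then j : nat else j') * M)%:Z.
have sep0 l l' : hi true j l < lo false j' l' \/ hi false j' l' < lo true j l.
  apply: contrapT => H.
  have h1 : lo false j' l' <= hi true j l by rewrite leNgt; apply/negP => h; apply: H; left.
  have h2 : lo true j l <= hi false j' l' by rewrite leNgt; apply/negP => h; apply: H; right.
  have [h|/ltW h] := leP (lo true j l) (lo false j' l').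
    have [l0 [z e]] := red false l'; apply: (nA l0); exists (l + (q true)%:Z * (- z)).
    by rewrite loz hiz; move: h h1; rewrite e !loz mulrNz => h h1; apply/andP; split; lra.
  have [l0 [z e]] := red true l; apply: (nB l0); exists (l' + (q false)%:Z * (- z)).
  by rewrite loz hiz; move: h h2; rewrite e !loz mulrNz => h h2; apply/andP; split; lra.
have /choice[F HF] c : exists F : lifted_homeo R, rot_num F = (p c)%:~R / (q c)%:R /\
    forall l, F (x c (I c l + o c + 3)) = x c (I c (l + p c + 1) + o c + 1).
  apply: (broken_orbit_map _ (q0 c) _ (kq c) (px c)).
  by apply: leq_trans (n4 c); rewrite mulnC leq_mul2l; apply/orP; right; rewrite /M; lia.
exists F; split; first by move=> c; have [] := HF c.
have FE c l : F c (x c (I c l + o c + 3)) = x c (I c (l + p c + 1) + o c + 1).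
  by have [_ ->] := HF c.
have gap c l : I c l + M%:Z <= I c (l + 1) by exact: cluster_idx_gap.
have shift c l : I c (l + p c) <= I c l + k c <= I c (l + p c) + 1.
  exact: cluster_idx_shift.
have M4 : (4 <= M)%N by rewrite /M; lia.
have In c l : I c (l + (q c)%:Z) = I c l + (n c)%:Z.
  by have := Iz c l 1; rewrite !mulr1.
have xn c i : x c (i + (n c)%:Z) = x c i + 1 by have [_ ->] := px c.
have eM : M%:Z = (2 * size s)%:Z + 4 by rewrite /M; lia.
have eM1 : (M.-1)%:Z = 3 + (2 * size s)%:Z by rewrite /M; lia.
have Mn c : (M <= n c)%N.
  by apply: leq_trans (n4 c); rewrite -{1}[M]mul1n leq_mul2r q0 orbT.
apply: (@arc_comparison R (2 * size s) phi F p (fun c l => x c (I c l + o c))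
   (fun c i l => x c (I c l + o c + 3 + i%:Z))) => //.
- move=> c v; have [i /andP[i1 i2]] := pseq_locate v (n0 c) (px c).
  pose y l := x c (I c l + o c).
  have py : pseq (q c) y.
    split=> l; rewrite /y.
      rewrite (pseq_lt _ _ (px c)); have := gap c l; move: (I c _) (I c _) => A B; lia.
    by rewrite In addrAC xn.
  exact: pseq_locate (q0 c) py.
- move=> c l; rewrite (pseq_le _ _ (px c)); move: (I c _) => A; lia.
- move=> c i i' l ii; rewrite (pseq_le _ _ (px c)); move: (I c _) => A; lia.
- move=> c i l; rewrite xk (pseq_le _ _ (px c)).
  have := shift c l; move: (I c _) (I c _) => A B; lia.
- move=> c l; rewrite xk (pseq_le _ _ (px c)).
  have := shift c l; move: (I c _) (I c _) => A B; lia.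
(* The possible excess of one index in [cluster_idx_shift] is absorbed by the offset 1 of the target
   of the jump. *)
- move=> c l; rewrite addr0 xk FE (pseq_le _ _ (px c)).
  by have := shift c (l + 1); rewrite (addrAC l 1); move: (I c _) (I c _) => A B; lia.
- move=> c l; rewrite (pseq_le _ _ (px c)); have := gap c l.
  move: (I c _) (I c _) => A B; lia.
- move=> c l; rewrite -xn (pseq_le _ _ (px c)); have := Mn c.
  move: (I c _) => A; lia.
- case=> l l' /=.
    have := sep0 l l'; rewrite /hi /lo /o eM1 !addrA; exact.
  by have := sep0 l' l; rewrite /hi /lo /o eM1 !addrA => -[]; [right|left].
Qed.

End BrokenOrbits.

(** * Compactness *)

Section BilipschitzModel.
Variables (R : realType) (phi : bool -> lifted_homeo R).
Local Notation phi' c := (lh_inv (phi c)).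

(** Iterates, from the identity, of h -> id/2 + (A h)/2, with A h the average of h composed with the
    two maps and their inverses; the inverses yield the lower Lipschitz bounds. *)
Fixpoint averaged (N : nat) (x : R) : R :=
  if N is N'.+1 then
    x / 2 + (averaged N' (phi true x) + averaged N' (phi false x)
      + averaged N' (phi' true x) + averaged N' (phi' false x)) / 8
  else x.

Lemma averagedS N x : averaged N.+1 x =
  x / 2 + (averaged N (phi true x) + averaged N (phi false x)
    + averaged N (phi' true x) + averaged N (phi' false x)) / 8.
Proof. by []. Qed.

Lemma lh_inv_le c (x y : R) : (phi' c x <= phi' c y) = (x <= y).
Proof. by rewrite -(lh_le (phi c)) !lh_invK. Qed.

Lemma lh_inv_comm c (x : R) : phi' c (x + 1) = phi' c x + 1.
Proof. by apply: (@lh_inj _ (phi c)); rewrite lh_comm !lh_invK. Qed.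

Lemma averaged_comm N x : averaged N (x + 1) = averaged N x + 1.
Proof. by elim: N x => //= N IH x; rewrite !lh_comm !lh_inv_comm !IH; lra. Qed.

Lemma averaged_le N x y : x <= y -> averaged N x <= averaged N y.
Proof.
elim: N x y => //= N IH x y xy.
have := IH (phi true x) (phi true y); have := IH (phi false x) (phi false y).
have := IH (phi' true x) (phi' true y); have := IH (phi' false x) (phi' false y).
rewrite !lh_le !lh_inv_le => /(_ xy) ? /(_ xy) ? /(_ xy) ? /(_ xy) ?; lra.
Qed.

Lemma displacement_bound (f : lifted_homeo R) x : `|f x - x| <= `|f 0| + 1.
Proof.
have [z /andP[z1 z2]] := floor_approx x.
have h1 : f 0 + z%:~R <= f x by rewrite -lh_addz lh_le add0r.
have h2 : f x <= f 0 + (z + 1)%:~R by rewrite -lh_addz lh_le add0r intrD ltW.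
rewrite intrD in h2; have := ler_norm (f 0); have := ler_norm (- f 0).
by rewrite normrN ler_norml => ? ?; apply/andP; split; lra.
Qed.

(** Displacements are bounded, and each step halves the uniform distance between consecutive
    iterates. *)
Lemma averaged_step :
  exists B : R, forall N x, `|averaged N.+1 x - averaged N x| <= B * (1 / 2) ^+ N.
Proof.
pose B := `|phi true 0| + `|phi false 0| + 1; exists B => N x.
have Bp c y : `|phi c y - y| <= B.
  apply: (le_trans (displacement_bound _ _)); rewrite /B.
  by have := normr_ge0 (phi true 0); have := normr_ge0 (phi false 0); case: c; lra.
have Bp' c y : `|phi' c y - y| <= B by rewrite distrC -{1}(lh_invK (phi c) y).
elim: N x => [|N IH] x.
  rewrite expr0 mulr1 /=; move: (Bp true x) (Bp false x) (Bp' true x) (Bp' false x).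
  rewrite !ler_norml => /andP[? ?] /andP[? ?] /andP[? ?] /andP[? ?].
  by apply/andP; split; lra.
have -> : B * (1 / 2) ^+ N.+1 = B * (1 / 2) ^+ N / 2 by rewrite exprSr; ring.
move: (IH (phi true x)) (IH (phi false x)) (IH (phi' true x)) (IH (phi' false x)).
rewrite (averagedS N.+1 x) (averagedS N x).
rewrite !ler_norml => /andP[? ?] /andP[? ?] /andP[? ?] /andP[? ?].
by apply/andP; split; lra.
Qed.

Lemma averaged_cvg x : cvgn (averaged ^~ x).
Proof.
have [B HB] := averaged_step.
pose u := fun N => averaged N.+1 x - averaged N x.
have e : averaged ^~ x = (fun N => series u N + x).
  apply/funext; elim=> [|N IH]; first by rewrite /series /= big_geq // add0r.
  have -> : series u N.+1 = series u N + u N by rewrite /series /= big_nat_recr.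
  rewrite addrAC -[series u N + x]IH /u; ring.
rewrite e; apply: is_cvgD; last exact: is_cvg_cst.
apply: normed_cvg; apply: (@series_le_cvg R _ (geometric B (1/2))) => //.
- by move=> n; exact: normr_ge0.
- by move=> n; exact: le_trans (normr_ge0 _) (HB n x).
- by move=> n; exact: HB.
- by apply: is_cvg_geometric_series; rewrite ger0_norm; lra.
Qed.

(* The coordinate [H = 1/2 sum_k (A/2)^k id], where [A] averages over the four
   maps, turns all of them into Lipschitz maps with a universal constant. *)
Lemma averaging_coordinate : exists H : R -> R,
  [/\ forall x y, x <= y -> H x <= H y, forall x, H (x + 1) = H x + 1 &
      forall x, H x = x / 2 + (H (phi true x) + H (phi false x)
        + H (phi' true x) + H (phi' false x)) / 8].
Proof.
pose H x := limn (averaged ^~ x); exists H.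
have Hc x : averaged ^~ x @ \oo --> H x by exact: averaged_cvg.
split=> [x y xy|x|x].
- by apply: (ler_cvg_to (Hc x) (Hc y)); near=> n; exact: averaged_le.
- apply: cvg_lim => //; under eq_fun do rewrite averaged_comm.
  by apply: cvgD; [exact: Hc|exact: cvg_cst].
- apply: cvg_lim => //; rewrite -cvg_shiftS /=.
  apply: cvgD; first exact: cvg_cst.
  by apply: cvgM; [do 3 (apply: cvgD; last exact: Hc); exact: Hc|exact: cvg_cst].
Unshelve. all: by end_near. Qed.

(** All terms in the equation of H are monotone, so each increment of H after a map is at most 8
    times the increment before. The pairs (H x, H (phi c x)) are thus bilipschitz data on the range
    of H; the extensions are semiconjugate to phi and keep its rotation numbers. *)
Lemma bilip_model : exists psi : bool -> lifted_homeo R,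
  (forall c x y, x <= y -> bilip 8 x y (psi c x) (psi c y)) /\
  exists H : R -> R, [/\ {homo H : x y / x <= y}, forall x, H (x + 1) = H x + 1 &
    forall c x, H (phi c x) = psi c (H x)].
Proof.
have [H [Hle H1 Hfix]] := averaging_coordinate.
have Hdiff x y c : x <= y ->
    [/\ (y - x) / 2 <= H y - H x, H (phi c y) - H (phi c x) <= 8 * (H y - H x) &
        H (phi' c y) - H (phi' c x) <= 8 * (H y - H x)].
  move=> xy.
  have h1 : H (phi true x) <= H (phi true y) by apply: Hle; rewrite lh_le.
  have h2 : H (phi false x) <= H (phi false y) by apply: Hle; rewrite lh_le.
  have h3 : H (phi' true x) <= H (phi' true y) by apply: Hle; rewrite lh_inv_le.
  have h4 : H (phi' false x) <= H (phi' false y) by apply: Hle; rewrite lh_inv_le.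
  by rewrite (Hfix x) (Hfix y); split; case: c; lra.
have HleE x y : H x <= H y -> x <= y.
  by move=> h; rewrite leNgt; apply/negP => yx; have [+ _ _] := Hdiff _ _ true (ltW yx); lra.
have H1' x : H (x - 1) = H x - 1 by rewrite -[in RHS](subrK 1 x) H1 addrK.
have Pc c : exists f : lifted_homeo R,
    (forall x y, x <= y -> bilip 8 x y (f x) (f y)) /\ forall x, H (phi c x) = f (H x).
  pose S := [set p : R * R | exists x, p = (H x, H (phi c x))].
  have [||||f [fS fK]] := @bilip_extension R 8 S (H 0) (H (phi c 0)).
  - lra.
  - by exists 0.
  - move=> _ _ [x [-> ->]]; split; first by exists (x + 1); rewrite lh_comm !H1.
    exists (x - 1); rewrite H1' -[in RHS](addrK 1 (phi c _)) -lh_comm subrK H1'.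
    by congr (_, _).
  - move=> _ _ _ _ [x [-> ->]] [y [-> ->]] /HleE xy; apply/andP; split.
      have := Hdiff (phi c x) (phi c y) c; rewrite lh_le !lh_funK.
      by case/(_ xy).
    by have [] := Hdiff x y c xy.
  by exists f; split=> // x; apply/esym/fS; exists x.
have [psi Hpsi] := choice Pc.
exists psi; split; first by move=> c; have [] := Hpsi c.
by exists H; split=> // c; have [] := Hpsi c.
Qed.

End BilipschitzModel.

(** * Limits along an ultrafilter *)

Section Compactness.
Variables (R : realType) (U : set_system nat).
Hypothesis U_ultra : UltraFilter U.
Let U_proper : ProperFilter U := ultra_proper.
#[local] Existing Instance U_proper.

Lemma ultra_bounded_cvg (u : nat -> R) (a b : R) :
  (\forall n \near U, a <= u n <= b) -> exists l : R, u @ U --> l.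
Proof.
move=> uab; have [|l [_ cl]] := @segment_compact R a b (fmap u U) (fmap_proper_filter u U_proper).
  by apply: filterS uab => n /=; rewrite in_itv.
exists l => A nA.
have [//|h] := in_ultra_setVsetC (u @^-1` A) U_ultra.
by have [y [/= h1 h2]] := cl (~` A) A h nA.
Qed.

(** Continuous convergence, with moving arguments, so that it is stable under composition and passes
    to words and iterates. *)
Definition uniformly_tends (f_ : nat -> R -> R) (f : R -> R) :=
  forall (x_ : nat -> R) x, x_ @ U --> x -> (fun n => f_ n (x_ n)) @ U --> f x.

Lemma bilip_uniformly_tends K (f_ : nat -> R -> R) f : 0 < K ->
  (forall n x y, x <= y -> bilip K x y (f_ n x) (f_ n y)) ->
  (forall x, f_ ^~ x @ U --> f x) -> uniformly_tends f_ f.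
Proof.
move=> K0 fK fc x_ x xc; apply/cvgrPdist_lt => e e0.
have e2 : 0 < e / 2 by lra.
have eK : 0 < e / 2 / K by rewrite divr_gt0.
near=> n.
have h1 : `|f x - f_ n x| < e / 2.
  by near: n; have /cvgrPdist_lt/(_ _ e2) := fc x.
have h2 : `|x - x_ n| < e / 2 / K.
  by near: n; move/cvgrPdist_lt : xc => /(_ _ eK).
have h3 : `|f_ n x - f_ n (x_ n)| < e / 2.
  have nn (y z : R) : y <= z -> 0 <= f_ n z - f_ n y <= K * (z - y).
    move=> yz; have /andP[g1 g2] := fK n _ _ yz; rewrite g2 andbT -(pmulr_rge0 _ K0).
    by rewrite (le_trans _ g1) // subr_ge0.
  rewrite ltr_pdivlMr // mulrC in h2; have [xx|/ltW xx] := leP x (x_ n).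
    have /andP[g1 g2] := nn _ _ xx; rewrite distrC ger0_norm //; apply: (le_lt_trans g2).
    by rewrite -[X in K * X]ger0_norm ?subr_ge0 // distrC.
  have /andP[g1 g2] := nn _ _ xx; rewrite ger0_norm //; apply: (le_lt_trans g2).
  by rewrite -[X in K * X]ger0_norm ?subr_ge0.
have -> : f x - f_ n (x_ n) = (f x - f_ n x) + (f_ n x - f_ n (x_ n)) by lra.
by rewrite (le_lt_trans (ler_normD _ _)) //; lra.
Unshelve. all: by end_near. Qed.

Lemma uniformly_tends_pact (phi_ : nat -> bool -> lifted_homeo R) (phi : bool -> lifted_homeo R) s :
  (forall c, uniformly_tends (fun n => phi_ n c) (phi c)) ->
  uniformly_tends (fun n => pact (phi_ n) s) (pact phi s).
Proof. by move=> H; elim: s => [//|c s IH] x_ x xc; apply: H; exact: IH. Qed.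

Lemma iter_tends (f_ : nat -> R -> R) f k :
  uniformly_tends f_ f -> (fun n => iter k (f_ n) 0) @ U --> iter k f 0.
Proof. by move=> H; elim: k => [|k IH]; [exact: cvg_cst|exact: H IH]. Qed.

End Compactness.

(** The bilipschitz models have pointwise limits along an ultrafilter finer than [\oo]. The bound
    |f^k(0) - k rot(f)| <= 1 is uniform in f, so it survives the limit and identifies the rotation
    numbers. *)
Lemma positive_word_limit (R : realType) (s : seq bool) (r : bool -> R) (v : R)
    (phi_ : nat -> bool -> lifted_homeo R) (v_ : nat -> R) :
  (forall c, (fun n => rot_num (phi_ n c)) @ \oo --> r c) ->
  (forall n, v_ n <= rot_num (pact (phi_ n) s)) -> v_ @ \oo --> v ->
  exists phi, (forall c, rot_num (phi c) = r c) /\ v <= rot_num (pact phi s).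
Proof.
move=> rc vle vc.
have /choice[psi_ Hpsi] n := bilip_model (phi_ n).
have psiK n c x y : x <= y -> bilip 8 x y (psi_ n c x) (psi_ n c y).
  by have [h _] := Hpsi n; exact: h.
have rotE n c : rot_num (phi_ n c) = rot_num (psi_ n c).
  by have [_ [H [H0 H1 H2]]] := Hpsi n; exact: (rot_semiconj H0 H1 (H2 c)).
have rotpE n : rot_num (pact (phi_ n) s) = rot_num (pact (psi_ n) s).
  have [_ [H [H0 H1 H2]]] := Hpsi n; apply: (rot_semiconj H0 H1).
  by elim: s {vle} => //= c s IH x; rewrite H2 IH.
have [U [UU Uoo]] := @ultraFilterLemma nat \oo _.
have UP : ProperFilter U := @ultra_proper _ _ UU.
have rcU c : (fun n => rot_num (psi_ n c)) @ U --> r c.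
  apply: cvg_trans (rc c); rewrite (_ : (fun n => _) = (fun n => rot_num (phi_ n c))).
    by move=> A /= h; exact: Uoo.
  by apply/funext => n; rewrite rotE.
have vcU : v_ @ U --> v by apply: cvg_trans vc => A /= h; exact: Uoo.
have lim_ex c x : exists l : R, (fun n => psi_ n c x) @ U --> l.
  (* The 2 covers the distance of the rotation number to its limit and the error of [rot_bound]; the
     rest is the Lipschitz bound. *)
  apply: (@ultra_bounded_cvg R U UU _ (r c - 2 - 8 * `|x|) (r c + 2 + 8 * `|x|)).
  near=> n.
  have h1 : `|r c - rot_num (psi_ n c)| < 1.
    by near: n; have /cvgrPdist_lt/(_ _ ltr01) := rcU c.
  have := rot_bound (psi_ n c) 1; rewrite mul1r /= => h2.
  have h3 : `|psi_ n c x - psi_ n c 0| <= 8 * `|x|.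
    have [x0|/ltW x0] := leP 0 x; have /andP[g1 g2] := psiK n c _ _ x0.
      rewrite !ger0_norm //; lra.
    rewrite distrC (ler0_norm x0) ger0_norm; lra.
  move: h1 h2 h3; rewrite ltr_norml !ler_norml => /andP[? ?] /andP[? ?] /andP[? ?].
  by apply/andP; split; lra.
have [F HF] : exists F : bool -> R -> R, forall c x, (fun n => psi_ n c x) @ U --> F c x.
  exists (fun c => projT1 (choice (lim_ex c))) => c x.
  exact: (projT2 (choice (lim_ex c)) x).
have FK c x y : x <= y -> bilip 8 x y (F c x) (F c y).
  move=> xy; have hd : (fun n => psi_ n c y - psi_ n c x) @ U --> F c y - F c x.
    by apply: cvgB; exact: HF.
  have hd8 : (fun n => 8 * (psi_ n c y - psi_ n c x)) @ U --> 8 * (F c y - F c x).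
    by apply: cvgM; [exact: cvg_cst|exact: hd].
  apply/andP; split.
    have hc : (fun=> y - x) @ U --> y - x by exact: cvg_cst.
    apply: (ler_cvg_to hc hd8).
    by near=> n; have /andP[] := psiK n c _ _ xy.
  have hc : (fun=> 8 * (y - x)) @ U --> 8 * (y - x) by exact: cvg_cst.
  apply: (ler_cvg_to hd hc).
  by near=> n; have /andP[] := psiK n c _ _ xy.
have F1 c x : F c (x + 1) = F c x + 1.
  have h1 := HF c (x + 1); have : (fun n => psi_ n c (x + 1)) @ U --> F c x + 1.
    rewrite (_ : (fun n => _) = (fun n => psi_ n c x + 1)).
      by apply: cvgD; [exact: HF|exact: cvg_cst].
    by apply/funext => n; rewrite lh_comm.
  by apply: cvg_unique h1.
have K0 : 0 < 8 :> R by lra.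
have /choice[phi Hphi] c := bilip_homeo K0 (FK c) (F1 c).
have tends c : uniformly_tends U (fun n => psi_ n c) (phi c).
  apply: (@bilip_uniformly_tends R U UU 8) => // [n x y|x]; first exact: psiK.
  by rewrite Hphi; exact: HF.
exists phi; split=> [c|].
  apply: (@rot_num_unique _ _ _ 1) => k.
  have h : (fun n => `|iter k (psi_ n c) 0 - k%:R * rot_num (psi_ n c)|) @ U -->
      `|iter k (phi c) 0 - k%:R * r c|.
have h0 := iter_tends (k := k) UU (tends c).
    apply: cvg_norm; apply: cvgB => //.
    by apply: cvgM; [exact: cvg_cst|exact: rcU].
  have hc : (fun=> 1 : R) @ U --> (1 : R) by exact: cvg_cst.
  apply: (ler_cvg_to h hc).
  by near=> n; exact: rot_bound.
(* One unit of error comes from [rot_bound] for the models, one from [rot_bound] for the limit. *)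
apply: (@le_of_mul_bounded _ _ _ 2) => k.
have h : k%:R * v - 1 <= iter k (pact phi s) 0.
  have h1 : (fun n => k%:R * v_ n - 1) @ U --> k%:R * v - 1.
    by apply: cvgB; [apply: cvgM; [exact: cvg_cst|exact: vcU]|exact: cvg_cst].
  apply: (ler_cvg_to h1 (iter_tends UU (uniformly_tends_pact tends))).
  near=> n; have := rot_bound (pact (psi_ n) s) k; rewrite -rotpE ler_norml.
  have := ler_wpM2l (ler0n R k) (vle n); lra.
by have := rot_bound (pact phi s) k; rewrite ler_norml; lra.
Unshelve. all: by end_near. Qed.

(** * Raising one letter *)

(** An odd numerator over a power of two is reduced. With z the floor of r 2^N / 2, the odd number
    2z + 3 exceeds r 2^N by at most 3. *)
Lemma dyadic_above (R : realType) (r : R) (N : nat) : exists k : int,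
  coprime `|k| (2 ^ N) /\ r <= k%:~R / (2 ^ N)%:R <= r + 3 / (2 ^ N)%:R.
Proof.
have n0 : 0 < (2 ^ N)%:R :> R by rewrite ltr0n expn_gt0.
have [z /andP[z1 z2]] := floor_approx (r * (2 ^ N)%:R / 2).
exists (2 * z + 3); split.
  by apply: coprimeXr; rewrite coprimen2; lia.
rewrite ler_pdivlMr // -[X in _ / _ <= X + _](mulfK (lt0r_neq0 n0)) -mulrDl ler_pM2r ?invr_gt0 //.
by rewrite intrD intrM; apply/andP; split; lra.
Qed.

Lemma short_gap (q n : nat) (b : nat -> int) : (0 < q)%N ->
  b q <= b 0%N + n%:Z -> exists j, q%:Z * (b j.+1 - b j) <= n%:Z.
Proof.
move=> q0 bq; apply: contrapT => H.
have H' j : n%:Z < q%:Z * (b j.+1 - b j).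
  by rewrite ltNge; apply/negP => h; apply: H; exists j.
have : forall j : nat, j%:Z * (n%:Z + 1) <= q%:Z * (b j - b 0%N).
  elim=> [|j IH]; first by rewrite subrr mulr0 mul0r.
  by have := H' j; move: IH; rewrite -addn1 PoszD; lia.
move=> /(_ q); nia.
Qed.

(** The number t is d times the inverse of p modulo q. *)
Lemma residue_step (p : int) (q : nat) (d : int) : (0 < q)%N -> coprime `|p| q ->
  exists (t : nat) (z : int), (t < q)%N /\ t%:Z * p = d + q%:Z * z.
Proof.
move=> q0 pq; have [u [v uv]] := Bezoutz p q%:Z.
have uv1 : u * p + v * q%:Z = 1 by rewrite uv /gcdz; move: pq; rewrite /coprime => /eqP ->.
have qn : q%:Z != 0 by lia.
have h0 := modz_ge0 (d * u) qn.
have h1 : ((d * u) %% q%:Z)%Z < q%:Z by apply: ltz_pmod; lia.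
have e := divz_eq (d * u) q%:Z.
exists `|((d * u) %% q%:Z)%Z|%N, (- d * v - ((d * u) %/ q%:Z)%Z * p); split; first by lia.
rewrite gez0_abs //.
have -> : ((d * u) %% q%:Z)%Z = d * u - ((d * u) %/ q%:Z)%Z * q%:Z by rewrite {2}e; ring.
have -> : (d * u - ((d * u) %/ q%:Z)%Z * q%:Z) * p =
  d * (u * p + v * q%:Z) + q%:Z * (- d * v - ((d * u) %/ q%:Z)%Z * p) by ring.
by rewrite uv1 mulr1.
Qed.

Section RaisePower.
Variable R : realType.
Implicit Types (f g : lifted_homeo R) (phi psi : bool -> lifted_homeo R).

(* As [p] is invertible modulo [q], the residue of [j] is met in every [q] steps. *)
Lemma rot_gain (W : lifted_homeo R) (p : int) (q : nat) (y : int -> R) (j : int) :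
  (0 < q)%N -> coprime `|p| q -> pseq q y ->
  (forall i, y (i + p) <= W (y i)) -> y (j + p + 1) <= W (y j) ->
  p%:~R / q%:R + 1 / q%:R ^+ 2 <= rot_num W.
Proof.
move=> q0 pq py Wy Wj.
have it t i : y (i + t%:Z * p) <= iter t W (y i).
  elim: t => [|t IH]; first by rewrite mul0r addr0.
  rewrite iterS (le_trans _ (_ : W (y (i + t%:Z * p)) <= _)) ?lh_le //.
  by rewrite (le_trans _ (Wy _)) // (pseq_le _ _ py); lia.
have Wjz z : y (j + q%:Z * z + p + 1) <= W (y (j + q%:Z * z)).
  rewrite (_ : j + q%:Z * z + p + 1 = j + p + 1 + q%:Z * z); last by ring.
  by rewrite !(pseq_addz _ _ py) lh_addz lerD2r.
(* After t steps the orbit is at or beyond a translate of y j; the next step gains one index, and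
   the remaining q - t - 1 steps lose nothing. *)
have gain i : y (i + (q%:Z * p + 1)) <= iter q W (y i).
  have [t [z [tq tz]]] := residue_step (j - i) q0 pq.
  have -> : q = ((q - t.+1) + t.+1)%N by lia.
  rewrite iterD iterS; apply: (@le_trans _ _ (iter (q - t.+1) W (y (j + q%:Z * z + p + 1)))).
    apply: le_trans (it _ _); rewrite (pseq_le _ _ py).
    have -> : j + q%:Z * z = i + t%:Z * p by rewrite tz; lia.
    by rewrite subnK //; have -> : (q - t.+1)%:Z = q%:Z - t%:Z - 1 :> int; lia.
  rewrite iter_le; apply: le_trans (Wjz z) _; rewrite lh_le; apply: le_trans (it _ _).
  by rewrite tz (pseq_le _ _ py); lia.
have gains t i : y (i + t%:Z * (q%:Z * p + 1)) <= iter (t * q) W (y i).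
  elim: t => [|t IH]; first by rewrite mul0r addr0.
  rewrite mulSn iterD; apply: (@le_trans _ _ (iter q W (y (i + t%:Z * (q%:Z * p + 1))))).
    by apply: le_trans (gain _); rewrite (pseq_le _ _ py); lia.
  by rewrite iter_le.
have qR : q%:R != 0 :> R by rewrite pnatr_eq0 -lt0n.
have -> : p%:~R / q%:R + 1 / q%:R ^+ 2 = (q%:Z * p + 1)%:~R / (q * q)%:R :> R.
  by rewrite intrD intrM natrM -[(Posz q)%:~R]/(q%:R); field.
apply: (@rot_ge_period _ W (q * q) _ (y 0)) => [|k]; first by rewrite muln_gt0 q0.
rewrite mulnA; apply: le_trans (gains _ _).
rewrite -[k%:R]/(k%:~R) -intrM -(pseq_addz _ _ py) (pseq_le _ _ py); lia.
Qed.

Lemma raise_power phi s c m (u v : seq bool) (p : int) (q : nat) (N : nat) :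
  s = u ++ nseq m c ++ v -> (0 < m)%N -> (0 < q)%N -> coprime `|p| q ->
  rot_num (pact phi s) = p%:~R / q%:R ->
  exists psi, [/\ rot_num (psi (~~ c)) = rot_num (phi (~~ c)),
    rot_num (psi c) <= rot_num (phi c) + 1 / (m * q)%:R + 4 / (2 ^ N)%:R &
    p%:~R / q%:R + 1 / q%:R ^+ 2 <= rot_num (pact psi s)].
Proof.
move=> es m0 q0 pq rs; set n := (2 ^ N)%N.
have n0 : (0 < n)%N by rewrite expn_gt0.
have [k [kn /andP[rk kr]]] := dyadic_above (rot_num (phi c)) N.
have [f1 [rf1 f1_ge]] := rot_raise rk.
have [x px f1x] := periodic_orbit n0 kn rf1.
(* A cyclic permutation puts the block first in order of application, without changing the rotation
   number. *)
have rotE psi : rot_num (pact psi s) = rot_num (pact psi (v ++ u ++ nseq m c)).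
  by rewrite es catA [LHS](congr1 _ (pact_cat _ _ _)) rot_mulC -pact_cat.
have [y py Wy] := periodic_orbit q0 pq (etrans (esym (rotE phi)) rs).
have actE psi t : pact psi (v ++ u ++ nseq m c) t = pact psi (v ++ u) (iter m (psi c) t).
  by rewrite catA pact_cat -pact_nseq.
have /choice[b hb] (j : int) : exists i : int, x i <= y j < x (i + 1).
  exact: (pseq_locate (y j) n0 px).
have bq : b (q : int) <= b 0 + n%:Z.
  have /andP[h1 _] := hb q; have /andP[_ h2] := hb 0.
  have e : y (q : int) = y 0 + 1 by have [_ <-] := py; rewrite add0r.
  have : x (b q) < x (b 0 + 1 + n%:Z) by have [_ ->] := px; rewrite (le_lt_trans h1) // e ltrD2r.
  rewrite (pseq_lt _ _ px); lia.
have [j hj] := @short_gap q n (fun j => b j%:Z) q0 bq.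
have /andP[yj1 yj2] := hb j; have /andP[yj3 yj4] := hb j.+1.
have jS : j.+1%:Z = j%:Z + 1 by rewrite -addn1.
have bj : b j%:Z <= b j.+1%:Z.
  have : x (b j%:Z) < x (b j.+1%:Z + 1).
    by rewrite (le_lt_trans yj1) // (lt_trans _ yj4) // (pseq_lt _ _ py); lia.
  rewrite (pseq_lt _ _ px); lia.
pose L := `|b j.+1%:Z - b j%:Z|%N.
have eL : b j.+1%:Z = b j%:Z + L%:Z by rewrite /L; lia.
(* The least d with m d > L: shifting by d more indices under c carries the block past the gap, at a
   cost of d/n <= L/(mn) + 1/n in rotation number. *)
pose d := (L %/ m).+1.
have md : (L < m * d)%N by rewrite mulnC /d ltn_ceil.
have [f2 f2x] : exists f : lifted_homeo R, forall i, f (x i) = x (i + (k + d%:Z)).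
  apply: (interpolation n0 px); case: px => p1 p2; split=> i; first by rewrite addrAC.
  by rewrite addrAC.
have f2_f1 t : f1 t <= f2 t.
  have [i /andP[i1 /ltW i2]] := pseq_locate t n0 px.
  apply: (@le_trans _ _ (f1 (x (i + 1)))); first by rewrite lh_le.
  apply: (@le_trans _ _ (f2 (x i))); last by rewrite lh_le.
  by rewrite f1x f2x (pseq_le _ _ px) /d; lia.
have itx f (e : int) : (forall i, f (x i) = x (i + e)) ->
    forall t i, iter t f (x i) = x (i + t%:Z * e).
  move=> fx; elim=> [|t IH] i; first by rewrite mul0r addr0.
  by rewrite iterS IH fx; congr x; lia.
pose psi c' := if c' == c then f2 else phi c'.
have psic : psi c = f2 by rewrite /psi eqxx.
have psi_ge c' t : phi c' t <= psi c' t.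
  rewrite /psi; case: eqP => [->|//]; exact: le_trans (f1_ge t) (f2_f1 t).
exists psi; split.
- by rewrite /psi; case: (c).
- rewrite psic (@rot_period R f2 n (k + d%:Z) (x 0) n0); last first.
    (* In the total 4/n, 3/n comes from the dyadic approximation and 1/n from rounding L/m. *)
    by rewrite (itx _ _ f2x) (pseq_addz _ _ px).
  have nR : 0 < n%:R :> R by rewrite ltr0n.
  have mR : 0 < m%:R :> R by rewrite ltr0n.
  have qR : 0 < q%:R :> R by rewrite ltr0n.
  rewrite intrD mulrDl.
  suff : (d%:Z)%:~R / n%:R <= 1 / (m * q)%:R + 1 / n%:R :> R.
    by move=> h; move: kr; rewrite -/n; lra.
  rewrite -[_%:~R]/(d%:R) ler_pdivrMr // mulrDl mul1r divfK ?gt_eqF //.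
  rewrite -natr1 lerD2r mulrC natrM ler_pdivlMr ?mulr_gt0 //.
  rewrite -!natrM ler_nat mulnA.
  have h1 : (L %/ m * m <= L)%N by exact: leq_trunc_div.
  have h2 : (q * L <= n)%N by move: hj; rewrite eL addrAC subrr add0r -PoszM lez_nat.
  by apply: leq_trans h2; rewrite [leqRHS]mulnC leq_mul2r h1 orbT.
- rewrite rotE; apply: (@rot_gain _ p q y j%:Z) => //.
    by move=> i; rewrite -Wy; exact: pact_le.
  rewrite actE psic (_ : j%:Z + p + 1 = j.+1%:Z + p); last by lia.
  rewrite -Wy actE.
  apply: (@le_trans _ _ (pact psi (v ++ u) (iter m (phi c) (y j.+1%:Z)))).
    exact: pact_le.
  (* The point y (j + 1) is below the orbit point of index b (j + 1) + 1 and y j is not below that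
     of index b j, so the block must gain L + 1 indices. *)
  rewrite lh_le; apply: (@le_trans _ _ (iter m f1 (x (b j.+1%:Z + 1)))).
    by apply: iter_mono => //; exact: ltW.
  apply: (@le_trans _ _ (iter m f2 (x (b j%:Z)))); last by rewrite iter_le.
  rewrite (itx _ _ f1x) (itx _ _ f2x) (pseq_le _ _ px) eL mulrDr.
  have : (L%:Z + 1 <= m%:Z * d%:Z) by lia.
  lia.
Qed.

End RaisePower.

(** * Homomorphisms from the free group *)

Section FreeGroupAction.
Variables (R : realType) (phi : bool -> lifted_homeo R).

Definition letter_act (l : bool * bool) : lifted_homeo R :=
  if l.2 then ((phi l.1)^-1)%g else phi l.1.

Definition word_act (s : seq (bool * bool)) : lifted_homeo R :=
  foldr (fun l h => letter_act l * h)%g 1%g s.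

Definition free_act (w : F2) : lifted_homeo R := word_act (word w).

Lemma letter_act_linv l : (letter_act l * letter_act (linv l))%g = 1%g.
Proof. by case: l => x []; rewrite /letter_act /= ?mulVg ?mulgV. Qed.

Lemma word_act_push l s : word_act (push l s) = (letter_act l * word_act s)%g.
Proof.
case: s => [|l' s] //=; case: eqP => [->|//].
by rewrite mulgA letter_act_linv mul1g.
Qed.

Lemma free_actM : {morph free_act : v w / (v * w)%g >-> (v * w)%g}.
Proof.
move=> v w; rewrite /free_act /=; elim: (word v) => [|l s IH] /=; first by rewrite mul1g.
by rewrite word_act_push IH mulgA.
Qed.

HB.instance Definition _ := isMultiplicative.Build F2 (lifted_homeo R) free_act free_actM.

Lemma free_act_gen c : free_act (fg_gen c : F2) = phi c.
Proof. by rewrite /free_act /= mulg1. Qed.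

End FreeGroupAction.

(** * The maximal rotation number of a positive word *)

Section MaximalRotationNumber.
Variable R : realType.
Implicit Types (phi psi : bool -> lifted_homeo R) (w : F2).

Definition letters w : seq bool := unzip1 (word w).

(** Nothing cancels in a positive word, so prepending a letter is multiplication by a generator. *)
Lemma multiplicative_letters (rho : {multiplicative F2 -> lifted_homeo R}) w :
  positive_word w -> rho w = pact (fun c => rho (fg_gen c)) (letters w).
Proof.
case: w => s; rewrite /positive_word /letters /=.
elim: s => [|[c b] s IH] rs /=.
  move=> _; rewrite (_ : FreeWord rs = 1%g :> F2); last exact: val_inj.
  have e : (rho 1 * rho 1)%g = rho 1%g by rewrite -gmulfM mulg1.
  by apply: (@mulgI _ (rho 1%g)); rewrite e mulg1.
case/andP => /negbTE b0; rewrite {}b0 in rs * => ps; have rs' := path_sorted rs.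
rewrite -(IH rs' ps) -gmulfM; congr (rho _); apply: val_inj => /=.
by case: s rs ps {IH rs'} => //= l s /andP[/negbTE->].
Qed.

Definition rotations (r s : R) phi := rot_num (phi true) = r /\ rot_num (phi false) = s.

(** By freeness, homomorphisms correspond to arbitrary pairs of maps. *)
Lemma maxrotE w (r s : R) : positive_word w ->
  maxrot w r s = ereal_sup [set (rot_num (pact phi (letters w)))%:E | phi in rotations r s].
Proof.
move=> pw; congr ereal_sup; apply/seteqP; split=> [_ [rho [ra rb] <-]|_ [phi [ra rb] <-]].
  exists (fun c => rho (fg_gen c)) => //.
  by rewrite multiplicative_letters.
pose rho : {multiplicative F2 -> lifted_homeo R} := free_act phi; exists rho.
  by split; [rewrite -ra|rewrite -rb]; congr rot_num; exact: free_act_gen.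
have phiE : (fun c => rho (fg_gen c)) = phi by apply/funext => c; exact: free_act_gen.
have := multiplicative_letters rho pw; rewrite phiE.
exact: (congr1 (fun h => (rot_num h)%:E)).
Qed.

Lemma maxrot_le w (r s r' s' : R) : positive_word w ->
  (forall phi, rotations r s phi -> exists2 psi, rotations r' s' psi &
    rot_num (pact phi (letters w)) <= rot_num (pact psi (letters w))) ->
  (maxrot w r s <= maxrot w r' s')%E.
Proof.
move=> pw H; rewrite !maxrotE //; apply: ge_ereal_sup => _ [phi hphi <-].
have [psi hpsi le] := H phi hphi.
apply: (@le_trans _ _ (rot_num (pact psi (letters w)))%:E); first by rewrite lee_fin.
by apply: ereal_sup_ubound; exists psi.
Qed.

Lemma raise_rotations t phi (r : bool -> R) : (forall c, rot_num (phi c) <= r c) ->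
  exists psi, (forall c, rot_num (psi c) = r c) /\
    rot_num (pact phi t) <= rot_num (pact psi t).
Proof.
move=> H; have /choice[psi hpsi] c := rot_raise (H c).
exists psi; split; first by move=> c; have [] := hpsi c.
by apply: rot_mono; apply: pact_le => c; have [] := hpsi c.
Qed.

Definition pick2 (r s : R) (c : bool) := if c then r else s.

Lemma rotationsP (r s : R) phi : rotations r s phi <-> forall c, rot_num (phi c) = pick2 r s c.
Proof. by split=> [[? ?] []|h] //; split; rewrite h. Qed.

Lemma maxrot_mono w (r s r' s' : R) : positive_word w -> r <= r' -> s <= s' ->
  (maxrot w r s <= maxrot w r' s')%E.
Proof.
move=> pw rr ss; apply: maxrot_le => // phi [pr ps].
have [|psi [h1 h2]] := @raise_rotations (letters w) phi (pick2 r' s').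
  by case; rewrite ?pr ?ps.
by exists psi => //; apply/rotationsP.
Qed.

Lemma letters_constant w : positive_word w -> constant (letters w) ->
  letters w = [::] \/ exists c k, w = (fg_gen c ^+ k.+1)%g.
Proof.
move=> pw; case e : (letters w) => [|c t] h; [by left|right].
have gen k : word (fg_gen c ^+ k : F2)%g = nseq k (c, false).
  elim: k => // k IH; rewrite expgS [LHS]/= IH.
  by case: (k) => //= k'; rewrite /linv /= xpair_eqE andbF.
exists c, (size t); apply: val_inj => /=; rewrite [RHS]gen.
have wE : word w = map (fun b => (b, false)) (letters w).
  rewrite /letters -map_comp; move: pw; rewrite /positive_word.
  by elim: (word w) => //= -[b [//|]] s IH /= /IH {1}->.
by rewrite wE e /=; move: h => /= /all_pred1P ->; rewrite map_nseq size_nseq.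
Qed.

(** Maps with rotation numbers slightly above p/q are raised to k/n, then replaced by broken-orbit
    maps of rotation number p/q at no loss for the word. Monotonicity gives the reverse
    inequality. *)
Lemma maxrot_locally_constant w (r s : rat) : positive_word w ->
  (forall k : nat, w <> (gen_a ^+ k.+1)%g /\ w <> (gen_b ^+ k.+1)%g) ->
  exists2 eps : R, 0 < eps & forall x y : R,
    ratr r <= x < ratr r + eps -> ratr s <= y < ratr s + eps ->
    maxrot w x y = maxrot w (ratr r) (ratr s).
Proof.
move=> pw nw; pose rs c : rat := if c then r else s.
suff [eps e0 H] : exists2 eps : R, 0 < eps & forall phi,
    (forall c, rot_num (phi c) < ratr (rs c) + eps) ->
    exists2 psi, forall c, rot_num (psi c) = ratr (rs c) &
      rot_num (pact phi (letters w)) <= rot_num (pact psi (letters w)).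
  exists eps => // x y /andP[x1 x2] /andP[y1 y2]; apply/eqP; rewrite eq_le.
  apply/andP; split; last exact: maxrot_mono.
  apply: maxrot_le => // phi [px py].
  have [|psi h1 h2] := H phi; first by case; rewrite ?px ?py.
  by exists psi => //; apply/rotationsP => -[]; rewrite h1.
have [/(letters_constant pw)[->|[c [k e]]]|nc] := boolP (constant (letters w)).
- exists 1 => // phi _; exists (fun c => lh_transl (ratr (rs c))) => // c.
  exact: rot_transl.
(* A power of one generator is excluded by hypothesis: its rotation number is a multiple of that of
   the generator, hence not locally constant. *)
- by have [] := nw k; rewrite e; case: (c).
pose p c := numq (rs c); pose q c := `|denq (rs c)|%N.
have q0 c : (0 < q c)%N by rewrite /q absz_gt0 denq_neq0.
have rE c : ratr (rs c) = (p c)%:~R / (q c)%:R :> R.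
  have h : (q c)%:Z = denq (rs c) by rewrite /q gez0_abs.
  by rewrite /ratr -[(q c)%:R]/((q c)%:Z%:~R) h.
have [k [n [kn H]]] := @rational_from_above R p q (letters w) q0 (fun c => coprime_num_den (rs c)) nc.
(* Since k q = p n + 1, the fraction k/n exceeds p/q by 1/(nq), which determines [eps]. *)
have kE c : (k c)%:~R / (n c)%:R = ratr (rs c) + 1 / ((n c)%:R * (q c)%:R) :> R.
  have [n0 /(congr1 (fun i : int => i%:~R : R))] := kn c.
  rewrite rE intrD !intrM -[(Posz (n c))%:~R]/((n c)%:R) -[(Posz (q c))%:~R]/((q c)%:R) => e.
  have nR : (n c)%:R != 0 :> R by rewrite pnatr_eq0 -lt0n.
  have qR : (q c)%:R != 0 :> R by rewrite pnatr_eq0 -lt0n.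
  apply: (mulIf qR); apply: (mulIf nR).
  rewrite mulrDl [_ / _ * _]mulrAC divfK // e mulrDl; field.
  by rewrite nR qR.
have gt0 c : 0 < 1 / ((n c)%:R * (q c)%:R) :> R.
  by have [n0 _] := kn c; rewrite divr_gt0 // mulr_gt0 ?ltr0n.
exists (Num.min (1 / ((n true)%:R * (q true)%:R)) (1 / ((n false)%:R * (q false)%:R))).
  by rewrite lt_min !gt0.
move=> phi hphi.
have [|phi1 [h1 h2]] := @raise_rotations (letters w) phi (fun c => (k c)%:~R / (n c)%:R).
  move=> c; rewrite kE; apply: le_trans (ltW (hphi c)) _; rewrite lerD2l ge_min.
  by case: c; rewrite lexx ?orbT.
have [psi [h3 h4]] := H phi1 h1.
by exists psi => [c|]; [rewrite rE h3|exact: le_trans h4].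
Qed.

(** The limit of a maximizing sequence has value at least v, and at most v as it competes in the
    supremum. *)
Lemma maxrot_attained w (r s v : R) : positive_word w -> maxrot w r s = v%:E ->
  exists2 phi, rotations r s phi & rot_num (pact phi (letters w)) = v.
Proof.
move=> pw hv.
have /choice[phi_ hphi] n : exists phi, rotations r s phi /\
    v - n.+1%:R^-1 <= rot_num (pact phi (letters w)).
  have : ((v - n.+1%:R^-1)%:E < maxrot w r s)%E.
    by rewrite hv lte_fin ltrBlDr ltrDl invr_gt0 ltr0n.
  rewrite maxrotE // => /ereal_sup_gt [_ [phi hphi <-]]; rewrite lte_fin => /ltW.
  by exists phi.
have [|||phi [h1 h2]] := @positive_word_limit R (letters w) (pick2 r s) v phi_
    (fun n => v - n.+1%:R^-1).
- move=> c; rewrite (_ : (fun n => _) = (fun=> pick2 r s c)); first exact: cvg_cst.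
  by apply/funext => n; have [/rotationsP->] := hphi n.
- by move=> n; have [] := hphi n.
- rewrite -[in X in _ --> X](subr0 v); apply: cvgB; [exact: cvg_cst|exact: cvg_harmonic].
exists phi; first exact/rotationsP.
apply/eqP; rewrite eq_le h2 andbT -lee_fin -hv maxrotE //.
by apply: ereal_sup_ubound; exists phi => //; apply/rotationsP.
Qed.

Lemma max_power_infix (c : bool) w : (0 < max_power c w)%N ->
  exists u v, letters w = u ++ nseq (max_power c w) c ++ v.
Proof.
rewrite /max_power; set m := (\max_(k < _ | _) _)%N => m0.
have : infix (nseq m (c, false)) (word w).
  rewrite /m; apply: (big_ind (fun k => infix (nseq k (c, false)) (word w))) => //.
    exact: infix0s.
  by move=> a b ha hb; rewrite /maxn; case: ifP.
case/infixP => u [v e]; exists (unzip1 u), (unzip1 v).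
by rewrite /letters e /unzip1 !map_cat map_nseq.
Qed.

(** A maximizing pair is raised with an excess of 4/2^N in the letter c; compactness removes the
    excess as N grows. *)
Lemma maxrot_raise (c : bool) w (r r' : bool -> R) (p : int) (q : nat) :
  positive_word w -> (0 < q)%N -> coprime `|p| q ->
  maxrot w (r true) (r false) = (p%:~R / q%:R)%:E -> (0 < max_power c w)%N ->
  r' c = r c + 1 / (max_power c w * q)%:R -> r' (~~ c) = r (~~ c) ->
  ((p%:~R / q%:R + 1 / q%:R ^+ 2)%:E <= maxrot w (r' true) (r' false))%E.
Proof.
move=> pw q0 pq hv m0 r'c r'n.
have [phi hphi rphi] := maxrot_attained pw hv.
have [u [v e]] := max_power_infix m0.
pose rN N c' := if c' == c then r' c + 4 / (2 ^ N)%:R else r' c'.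
have phic c' : rot_num (phi c') = r c' by case: hphi => ? ?; case: c'.
have /choice[psi_ hpsi] N : exists psi, (forall c', rot_num (psi c') = rN N c') /\
    p%:~R / q%:R + 1 / q%:R ^+ 2 <= rot_num (pact psi (letters w)).
  have [psi [h1 h2 h3]] := raise_power N e m0 q0 pq rphi.
  have [|psi' [h4 h5]] := @raise_rotations (letters w) psi (rN N).
    move=> c'; rewrite /rN; have [->|ne] := eqVneq c' c; first by rewrite r'c -phic.
    have -> : c' = ~~ c by case: (c') (c) ne => [] [].
    by rewrite h1 phic r'n.
  by exists psi'; split=> //; exact: le_trans h5.
have [|||psi [h1 h2]] := @positive_word_limit R (letters w) r'
    (p%:~R / q%:R + 1 / q%:R ^+ 2) psi_ (fun=> p%:~R / q%:R + 1 / q%:R ^+ 2).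
- move=> c'; rewrite (_ : (fun n => _) = (fun n => rN n c')); last first.
    by apply/funext => n; have [-> _] := hpsi n.
  rewrite /rN; have [->|_] := eqVneq c' c; last exact: cvg_cst.
  rewrite -[in X in _ --> X](addr0 (r' c)); apply: cvgD; first exact: cvg_cst.
  rewrite (_ : (fun n => _) = geometric 4 (1 / 2)).
    by apply: cvg_geometric; rewrite ger0_norm; lra.
  by apply/funext => n; rewrite /geometric /= natrX expr_div_n expr1n mulrA mulr1.
- by move=> N; have [] := hpsi N.
- exact: cvg_cst.
apply: (@le_trans _ _ (rot_num (pact psi (letters w)))%:E); first by rewrite lee_fin.
by rewrite maxrotE //; apply: ereal_sup_ubound; exists psi.
Qed.

End MaximalRotationNumber.

Local Close Scope classical_set_scope.

Theorem mainTheorem2 (R : realType) (w : F2) (w_pos : positive_word w) :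
  ((forall k : nat, w <> (gen_a ^+ k.+1)%g /\ w <> (gen_b ^+ k.+1)%g) ->
    forall r s : rat, exists2 eps : R, 0 < eps &
      forall x y : R,
        ratr r <= x < ratr r + eps -> ratr s <= y < ratr s + eps ->
        maxrot w x y = maxrot w (ratr r) (ratr s))
  /\
  (forall (r s : R) (p : int) (q : nat),
    (0 < q)%N -> coprime `|p|%N q ->
    maxrot w r s = (p%:~R / q%:R)%:E ->
    (forall m : nat, m = max_power letter_a w -> (0 < m)%N ->
      ((p%:~R / q%:R + 1 / q%:R ^+ 2)%:E
        <= maxrot w (r + 1 / (m * q)%:R) s)%E)
    /\
    (forall n : nat, n = max_power letter_b w -> (0 < n)%N ->
      ((p%:~R / q%:R + 1 / q%:R ^+ 2)%:E
        <= maxrot w r (s + 1 / (n * q)%:R))%E)).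
Proof.
split=> [nw r s|r s p q q0 pq hv]; first exact: maxrot_locally_constant.
split=> m -> m0.
  exact: (@maxrot_raise R true w (pick2 r s) (pick2 _ s) p q w_pos q0 pq hv m0).
exact: (@maxrot_raise R false w (pick2 r s) (pick2 r _) p q w_pos q0 pq hv m0).
Qed.
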